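(* Let $\sigma:\Sigma\to\Sigma$ be a topologically transitive one-sided subshift of finite type over the alphabet $A$ and let $\psi:\Sigma\to\mathbb{R}$, $v:\Sigma\to(-\infty,0)$ and $u:\Sigma\to(0,+\infty)$ be Hölder continuous. Let $\mathcal{W}$ be a finite set of non-empty admissible words over $A$, and let $\mathcal{F}'_{\mathcal{W}}=\bigcup_{l=1}^\infty\mathcal{F}'_{\mathcal{W},l}$, where $$\mathcal{F}'_{\mathcal{W},l}=\bigcap_{\omega\in\mathcal{W}}\{\xi\in\Sigma:\xi\text{ does not contain }\omega^l\text{ as a subword}\}$$ and $\omega^l$ is the $l$-fold concatenation of $\omega$. Then for every $\alpha\in\mathbb{R}$ with $\alpha\notin\{\alpha^-_{\psi,v},\alpha^+_{\psi,v}\}$, $$\dim_u(\mathcal{UL}^\alpha_{\psi,v}\cap\mathcal{F}'_{\mathcal{W}})=\dim_u(\mathcal{L}^\alpha_{\psi,v}).$$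
   Context: Subshift of finite type (SFT): $A$ is a finite set with at least two symbols, and $\mathbb{M}:A\times A\to\{0,1\}$ is a matrix such that for each $a\in A$ there is $b\in A$ with $\mathbb{M}(a,b)=1$. A word or infinite sequence over $A$ is admissible if each of its subwords $ab$ of length two (consecutive letters) satisfies $\mathbb{M}(a,b)=1$ (the empty word and words of length one are admissible). Subwords are contiguous blocks. $\Sigma\subseteq A^{\mathbb{N}}$ ($\mathbb{N}=\{1,2,\dots\}$) is the set of admissible sequences and $\sigma(\xi_1\xi_2\cdots)=\xi_2\xi_3\cdots$. The SFT is topologically transitive iff for all $a,b\in A$ there is an admissible word $\rho$ (possibly empty) with $a\rho b$ admissible. For an admissible word $\omega$ of length $|\omega|$, $[\omega]=\{\xi\in\Sigma:\xi_1\cdots\xi_{|\omega|}=\omega\}$; $[\text{empty word}]=\Sigma$. Birkhoff sums: $S_nf=\sum_{k=0}^{n-1}f\circ\sigma^k$, $S_0f=0$; for an admissible word $\omega$, $S_\omega f=\sup_{\xi\in[\omega]}S_{|\omega|}f(\xi)$. Metrics: for distinct $\xi,\xi'\in\Sigma$ let $\xi\wedge\xi'$ be their longest common initial block; $d_1(\xi,\xi')=\exp(-|\xi\wedge\xi'|)$. Hölder continuity of functions on $\Sigma$ is with respect to $d_1$ (with some positive exponent). For Hölder continuous $u:\Sigma\to(0,+\infty)$, $d_u(\xi,\xi')=\exp(S_{\xi\wedge\xi'}(-u))$ for $\xi\neq\xi'$, which is a metric on $\Sigma$. The $u$-dimension $\dim_u(E)$ of $E\subseteq\Sigma$ is the Hausdorff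 dimension of $E$ in $(\Sigma,d_u)$ (with $\dim_u\varnothing=0$). Level sets: $\mathcal{L}^\alpha_{\psi,v}=\{\xi\in\Sigma:\lim_{n\to+\infty}S_n\psi(\xi)/S_nv(\xi)=\alpha\}$, $\mathcal{UL}^\alpha_{\psi,v}=\{\xi\in\Sigma:\sup_{n\in\mathbb{N}}|S_n\psi(\xi)-\alpha S_nv(\xi)|<+\infty\}$. Boundary values: $$\alpha^-_{\psi,v}=\inf_{\xi\in\Sigma}\liminf_{n\to+\infty}\frac{S_n\psi(\xi)}{S_nv(\xi)},\qquad \alpha^+_{\psi,v}=\sup_{\xi\in\Sigma}\limsup_{n\to+\infty}\frac{S_n\psi(\xi)}{S_nv(\xi)}.$$ *)

(* Defs.v *)
From HB Require Import structures.
From mathcomp Require Import all_boot all_order all_algebra.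
From mathcomp Require Import all_classical all_reals all_analysis.
Import Order.TTheory GRing.Theory Num.Theory.
Import numFieldNormedType.Exports.

Set Implicit Arguments.
Unset Strict Implicit.
Unset Printing Implicit Defensive.

Local Open Scope classical_set_scope.
Local Open Scope ring_scope.

Section HausdorffDimension.
Context {R : realType} {T : Type} (d : T -> T -> R).
Local Open Scope ereal_scope.

(* Equal to -oo on the empty set. *)
Definition diam (U : set T) : \bar R :=
  ereal_sup [set (d p.1 p.2)%:E | p in U `*` U].

(* diam(U)^s, with the conventions that the empty set always contributes 0 and
   that 0 ^ 0 = 1, so that s = 0 yields the counting measure. *)
Definition diam_pow (s : R) (U : set T) : \bar R :=
  if U == set0 then 0 else (diam U `^ s)%E.

Definition hausdorff_content (s delta : R) (E : set T) : \bar R :=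
  ereal_inf [set \sum_(0 <= i <oo) diam_pow s (U i) | U in
    [set U : nat -> set T |
      E `<=` \bigcup_i U i /\ forall i, diam (U i) <= delta%:E]].

Definition hausdorff_measure (s : R) (E : set T) : \bar R :=
  ereal_sup [set hausdorff_content s delta E | delta in
    [set delta : R | (0 < delta)%R]].

Definition hausdorff_dim (E : set T) : \bar R :=
  ereal_inf [set s%:E | s in
    [set s : R | (0 <= s)%R /\ hausdorff_measure s E = 0]].

End HausdorffDimension.

(* Sequences are indexed from 0: [xi i] is the letter number i + 1. *)
Record sft (A : finType) (M : rel A) := Sft {
  sft_seq :> nat -> A;
  sft_adm : forall i, M (sft_seq i) (sft_seq i.+1) }.

Definition admissible (A : finType) (M : rel A) (w : seq A) : bool := sorted M w.

Section Subshift.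
Context {A : finType} {M : rel A}.
Implicit Types (xi : sft M) (w : seq A).

Lemma sft_ext xi xi' : xi =1 xi' -> xi = xi'.
Proof.
case: xi xi' => [x xM] [y yM] /= /funext exy; subst y.
by congr Sft; apply: Prop_irrelevance.
Qed.

Definition shift xi : sft M :=
  @Sft A M (fun i => xi i.+1) (fun i => sft_adm xi i.+1).

Definition prefix_of xi (n : nat) : seq A := mkseq xi n.

Definition cylinder w : set (sft M) := [set xi | prefix_of xi (size w) = w].

Definition contains_subword xi w : Prop :=
  exists k, prefix_of (iter k shift xi) (size w) = w.

Definition wpow w (l : nat) : seq A := flatten (nseq l w).

(* The first (0-based) index at which the sequences differ, which is the length
   of their longest common prefix; junk value 0 when xi = xi'. *)
Definition wedge_len xi xi' : nat :=
  if pselect (exists i, xi i != xi' i) is left h then ex_minn h else 0%N.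

Definition wedge xi xi' : seq A := prefix_of xi (wedge_len xi xi').

Lemma wedge_longest xi xi' n : xi <> xi' ->
  prefix_of xi n = prefix_of xi' n <-> (n <= size (wedge xi xi'))%N.
Proof.
move=> neq; rewrite size_mkseq /wedge_len.
case: pselect => [h|h]; last first.
  case: neq; apply: sft_ext => i; apply/eqP/negPn/negP => hi.
  by apply: h; exists i.
case: ex_minnP => m mP mmin; split=> [e|nm].
  rewrite leqNgt; apply/negP => mn; move/eqP: mP; apply.
  by rewrite -(nth_mkseq (xi 0%N) xi mn) -(nth_mkseq (xi 0%N) xi' mn); congr nth.
apply/eq_in_map => i; rewrite mem_iota /= add0n => lti.
apply/eqP/negPn/negP => /mmin; rewrite leqNgt => /negP; apply.
exact: leq_trans nm.
Qed.

Definition avoid_powers (W : set (seq A)) (l : nat) : set (sft M) :=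
  \bigcap_(w in W) [set xi | ~ contains_subword xi (wpow w l)].

Definition avoid_some_power (W : set (seq A)) : set (sft M) :=
  \bigcup_(l in [set l : nat | (1 <= l)%N]) avoid_powers W l.

End Subshift.

Definition topologically_transitive (A : finType) (M : rel A) : Prop :=
  forall a b : A, exists rho : seq A, admissible M (a :: rcons rho b).

Section Thermodynamics.
Context {R : realType} {A : finType} {M : rel A}.
Implicit Types (f u psi v : sft M -> R) (xi : sft M).

Definition birkhoff (n : nat) f xi : R := \sum_(k < n) f (iter k shift xi).

Definition word_sup (w : seq A) f : R :=
  sup [set birkhoff (size w) f xi | xi in cylinder w].

Definition dist1 xi xi' : R :=
  if pselect (xi = xi') then 0 else expR (- (size (wedge xi xi'))%:R).

Definition hoelder_continuous f : Prop :=
  exists theta C : R, 0 < theta /\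
    forall xi xi', `|f xi - f xi'| <= C * dist1 xi xi' `^ theta.

Definition dist_u u xi xi' : R :=
  if pselect (xi = xi') then 0 else expR (word_sup (wedge xi xi') (\- u)).

Definition dim_u u (E : set (sft M)) : \bar R := hausdorff_dim (dist_u u) E.

Definition birkhoff_ratio psi v xi (n : nat) : R :=
  birkhoff n psi xi / birkhoff n v xi.

Definition level_set psi v (alpha : R) : set (sft M) :=
  [set xi | birkhoff_ratio psi v xi n @[n --> \oo] --> alpha].

Definition uniform_level_set psi v (alpha : R) : set (sft M) :=
  [set xi | (ereal_sup
    [set `|birkhoff n psi xi - alpha * birkhoff n v xi|%:E
      | n in [set n : nat | (1 <= n)%N]] < +oo)%E].

Definition alpha_minus psi v : \bar R :=
  ereal_inf [set limn_einf (EFin \o birkhoff_ratio psi v xi) | xi in setT].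

Definition alpha_plus psi v : \bar R :=
  ereal_sup [set limn_esup (EFin \o birkhoff_ratio psi v xi) | xi in setT].

End Thermodynamics.

(* Main.v *)
(** Put phi = psi - alpha v.  The level set consists of points with
    S_n phi = o(n), and, as alpha lies strictly between the boundary values,
    the sums S_n phi are unbounded above and below; hence some loops P and N at
    a fixed letter have positive, resp. negative, phi-sum on their cylinders.

    If the level set has positive t-dimensional measure, covering it by
    n-cylinders shows that for infinitely many n the sum of exp(t S_w(-u)) over
    the words w of length n with |S_w phi| <= e n is not exponentially small.
    For s < t the corresponding s-sum then grows exponentially.  Concatenate
    such words freely, inserting after each one a corrector made of powers of P
    and N whose sign is opposite to that of the sum accumulated so far.  The
    sums S_n phi stay bounded, and since each block contains long pieces of
    both P and N, while the sums along a power of a word drift in only one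
    direction, no long powers of words of W occur.  Correctors have length
    O(1) + O(e n), so for small e and large n they do not spoil the exponential
    growth, and a mass distribution argument gives positive s-dimensional
    measure. *)
Require Import Defs.
From HB Require Import structures.
From mathcomp Require Import all_boot all_order all_algebra.
From mathcomp Require Import all_classical all_reals all_analysis.
From mathcomp Require Import ring lra zify.
Import Order.TTheory GRing.Theory Num.Theory.
Import numFieldNormedType.Exports.

Local Open Scope classical_set_scope.
Local Open Scope ring_scope.

Set Implicit Arguments.
Unset Strict Implicit.
Unset Printing Implicit Defensive.

(* MathComp-Analysis has its own [shift]. *)
Local Notation shift := Defs.shift.

(** Dependent choice along a tree of words. It stands in for compactness of the shift space in
    [hoelder_pos_lower_bound] and for the construction of a measure in [escape]. *)
Lemma infinite_branch (T : Type) (P : seq T -> Prop) :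
  P [::] -> (forall w, P w -> exists a, P (rcons w a)) ->
  exists x : nat -> T, forall k, P (mkseq x k).
Proof.
move=> P0 PS.
have next (w : {w | P w}) : exists a, P (rcons (sval w) a).
  by case: w => w /= Pw; exact: PS.
have [c cP] := choice next.
pose step (w : {w | P w}) := exist P (rcons (sval w) (c w)) (cP w).
pose node k := iter k step (exist P [::] P0).
exists (fun k => c (node k)) => k.
suff -> : mkseq (fun k => c (node k)) k = sval (node k) by exact: svalP.
by elim: k => [//|k IH]; rewrite mkseqS IH.
Qed.

(** * Hausdorff null sets and comparison of dimensions *)

Section Hausdorff.
Context {R : realType} {T : Type} (d : T -> T -> R).
Hypothesis d_ge0 : forall x y, 0 <= d x y.

Lemma dist_le_diam (U : set T) x y : U x -> U y -> ((d x y)%:E <= diam d U)%E.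
Proof. by move=> Ux Uy; apply: ereal_sup_ubound; exists (x, y). Qed.

Lemma diam_le (U : set T) (r : R) :
  (forall x y, U x -> U y -> d x y <= r) -> (diam d U <= r%:E)%E.
Proof.
by move=> h; apply: ge_ereal_sup => _ [[x y] [/= Ux Uy] <-]; rewrite lee_fin h.
Qed.

Lemma diam_ge0 (U : set T) : U !=set0 -> (0 <= diam d U)%E.
Proof.
by move=> [x Ux]; apply: (le_trans _ (dist_le_diam Ux Ux)); rewrite lee_fin d_ge0.
Qed.

Lemma diam_pow_ge0 s (U : set T) : (0 <= diam_pow d s U)%E.
Proof. by rewrite /diam_pow; case: ifP => // _; rewrite poweR_ge0. Qed.

Lemma diam_pow_nonempty s (U : set T) : U !=set0 ->
  diam_pow d s U = (diam d U `^ s)%E.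
Proof. by rewrite /diam_pow => /set0P/negbTE ->. Qed.

Lemma le_diam_pow (s s' : R) (U : set T) : 0 <= s -> s <= s' ->
  (diam d U <= 1)%E -> (diam_pow d s' U <= diam_pow d s U)%E.
Proof.
move=> s0 ss' dU; have [->|/set0P U0] := eqVneq U set0.
  by rewrite /diam_pow eqxx.
rewrite !diam_pow_nonempty//; move: (diam_ge0 U0) dU.
case: (diam d U) => [r||]//; rewrite !lee_fin => r0 r1.
have [->|rn0] := eqVneq r 0; last by rewrite ger_powR// lt_def rn0 r0.
(* At diameter 0 the convention 0 ^ 0 = 1 would break monotonicity only for [s' = 0 < s], which
   [s <= s'] excludes. *)
have [s'0|s'n0] := eqVneq s' 0; last by rewrite powR0// powR_ge0.
by have -> : s = s' by apply/eqP; rewrite eq_le ss' s'0.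
Qed.

Lemma hausdorff_measure_eq0P s (E : set T) :
  hausdorff_measure d s E = 0%E <->
  forall delta eta : R, 0 < delta -> 0 < eta ->
    exists U : nat -> set T,
      [/\ E `<=` \bigcup_i U i, forall i, (diam d (U i) <= delta%:E)%E &
          (\sum_(0 <= i <oo) diam_pow d s (U i) < eta%:E)%E].
Proof.
split=> [E0 delta eta delta0 eta0|h].
  have : (hausdorff_content d s delta E < eta%:E)%E.
    apply: (@le_lt_trans _ _ 0%E); last by rewrite lte_fin.
    by rewrite -E0; apply: ereal_sup_ubound; exists delta.
  by move=> /ereal_inf_lt[_ [U [EU dU] <-] sU]; exists U.
apply/eqP; rewrite eq_le; apply/andP; split.
  apply: ge_ereal_sup => _ [delta /= delta0 <-].
  apply/lee_addgt0Pr => eta eta0; rewrite add0e.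
  have [U [EU dU sU]] := h _ _ delta0 eta0.
  by apply: ge_ereal_inf; exists (\sum_(0 <= i <oo) diam_pow d s (U i))%E; [exists U|exact: ltW].
apply: (@le_trans _ _ (hausdorff_content d s 1 E)).
  apply: le_ereal_inf_tmp => _ [U _ <-].
  by apply: nneseries_ge0 => i _ _; exact: diam_pow_ge0.
by apply: ereal_sup_ubound; exists 1 => //=.
Qed.

Lemma hausdorff_measure_eq0S s (E F : set T) : E `<=` F ->
  hausdorff_measure d s F = 0%E -> hausdorff_measure d s E = 0%E.
Proof.
move=> EF /hausdorff_measure_eq0P F0; apply/hausdorff_measure_eq0P => delta eta d0 e0.
have [U [FU dU sU]] := F0 _ _ d0 e0.
by exists U; split => //; exact: subset_trans FU.
Qed.

Lemma hausdorff_measure_eq0_le (s s' : R) (E : set T) : 0 <= s -> s <= s' ->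
  hausdorff_measure d s E = 0%E -> hausdorff_measure d s' E = 0%E.
Proof.
move=> s0 ss' /hausdorff_measure_eq0P E0; apply/hausdorff_measure_eq0P => delta eta d0 e0.
have [|U [EU dU sU]] := E0 (Num.min delta 1) _ _ e0; first by rewrite lt_min d0/=.
exists U; split => //.
  by move=> i; rewrite (le_trans (dU i))// lee_fin ge_min lexx.
apply: le_lt_trans sU; apply: lee_nneseries => i *; first exact: diam_pow_ge0.
by apply: le_diam_pow => //; rewrite (le_trans (dU i))// lee_fin ge_min lexx orbT.
Qed.

Lemma hausdorff_dimS (E F : set T) : E `<=` F ->
  (hausdorff_dim d E <= hausdorff_dim d F)%E.
Proof.
move=> EF; apply: ereal_inf_le_tmp => _ [s [s0 F0] <-].
by exists s => //; split=> //; exact: hausdorff_measure_eq0S F0.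
Qed.

(** Only the infimum of exponents matters, so a small loss is harmless; inserting [s + e / 2] below
    [s + e] also makes the smaller exponent positive when [s = 0]. *)
Lemma hausdorff_dim_le (E F : set T) :
  (forall s s', 0 < s -> s < s' ->
    hausdorff_measure d s E = 0%E -> hausdorff_measure d s' F = 0%E) ->
  (hausdorff_dim d F <= hausdorff_dim d E)%E.
Proof.
move=> h; apply: le_ereal_inf_tmp => _ [s [s0 E0] <-].
apply/lee_addgt0Pr => e e0; apply: ereal_inf_lbound; exists (s + e) => //=.
split; first by rewrite addr_ge0// ltW.
apply: (h (s + e / 2)); rewrite ?ltrD2l.
- by rewrite ltr_wpDl// divr_gt0.
- by rewrite ltr_pdivrMr// ltr_pMr// ltr1n.
- by apply: hausdorff_measure_eq0_le E0; rewrite // lerDl divr_ge0// ltW.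
Qed.

(** The listed words of one length are distinct tuples, so grouping by length and adding the missing
    nonnegative terms only increases the sum. *)
Lemma uniq_sum_by_size (A : finType) (b : seq A -> R) (s : seq (seq A)) (N K : nat) :
  (forall w, 0 <= b w) -> uniq s -> (forall w, w \in s -> (size w < K)%N) ->
  \sum_(w <- s | (N <= size w)%N) b w <=
  \sum_(N <= n < K) \sum_(t : n.-tuple A) b t.
Proof.
move=> b0 us sK.
have -> : \sum_(w <- s | (N <= size w)%N) b w =
    \sum_(w <- s) \sum_(N <= n < K) if size w == n then b w else 0.
  rewrite big_mkcond/= big_seq [RHS]big_seq; apply: eq_bigr => w /sK wK.
  case: leqP => Nw.
    rewrite (bigD1_seq (size w)) ?iota_uniq ?mem_index_iota ?Nw//= eqxx big1 ?addr0//.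
    by move=> n /negbTE; rewrite eq_sym => ->.
  rewrite big_nat big1// => n /andP[Nn _]; case: eqP => // wn.
  by move: Nw; rewrite wn ltnNge Nn.
rewrite exchange_big/=; apply: ler_sum => n _.
have -> : \sum_(w <- s) (if size w == n then b w else 0) =
    \sum_(t <- pmap insub s : seq (n.-tuple A)) b t.
  rewrite big_pmap; apply: eq_bigr => w _.
  by case: insubP => [t sw tw|/negbTE ->]//=; rewrite sw tw.
rewrite big_uniq ?pmap_sub_uniq//= big_mkcond/=; apply: ler_sum => t _.
by case: ifP.
Qed.

(** Borel-Cantelli argument: for each [N] the sets [U w] with [size w >= N] cover [E], and their
    total weight is at most the geometric tail [q ^+ N / (1 - q)]. *)
Lemma limsup_cover_null (A : finType) (U : seq A -> set T) (b : seq A -> R)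
    (s q : R) (E : set T) (N0 : nat) : 0 < q < 1 ->
  (forall delta, 0 < delta -> exists N, forall w, (N <= size w)%N ->
    (diam d (U w) <= delta%:E)%E) ->
  (forall w, 0 <= b w) ->
  (forall w, (diam_pow d s (U w) <= (b w)%:E)%E) ->
  (forall n, (N0 <= n)%N -> \sum_(t : n.-tuple A) b t <= q ^+ n) ->
  (forall x, E x -> forall N, exists2 w, (N <= size w)%N & U w x) ->
  hausdorff_measure d s E = 0%E.
Proof.
move=> /andP[q0 q1] dU b0 bU bq EU; apply/hausdorff_measure_eq0P => delta eta delta0 eta0.
have [N1 hN1] := dU _ delta0.
have qn1 : `|q| < 1 by rewrite ger0_norm// ltW.
have q1' : 0 < 1 - q by rewrite subr_gt0.
have [N2 _ hN2] : \forall n \near \oo, q ^+ n < eta * (1 - q).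
  have e0 : 0 < eta * (1 - q) by exact: mulr_gt0.
  have /cvgrPdist_lt/(_ _ e0) := @cvg_expr R q qn1.
  apply: filterS => n; rewrite sub0r normrN.
  by rewrite ger0_norm// exprn_ge0// ltW.
(* [N0] gives the geometric bound, [N1] the small diameters, [N2] a tail below [eta]. *)
pose N := maxn N0 (maxn N1 N2).
(* Words are enumerated by their codes; all other indices carry the empty set, which contributes
   0. *)
pose V j := if pickle_inv j is Some w then (if (N <= size w)%N then U w else set0) else set0.
exists V; split.
- move=> x Ex; have [w wN Uw] := EU _ Ex N; exists (pickle w) => //.
  by rewrite /V pickleK_inv wN.
- have d0 : (diam d set0 <= delta%:E)%E by apply: diam_le.
  move=> j; rewrite /V; case: pickle_inv => // w; case: ifPn => // Nw.
  by apply: hN1; apply: leq_trans Nw; rewrite /N; lia.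
apply: (@le_lt_trans _ _ (q ^+ N / (1 - q))%:E); last first.
  by rewrite lte_fin ltr_pdivrMr//; apply: hN2 => /=; rewrite /N; lia.
apply: lime_le; first by apply: is_cvg_nneseries => *; exact: diam_pow_ge0.
near=> J.
pose c j := oapp (fun w => if (N <= size w)%N then b w else 0) 0 (pickle_inv j).
apply: (@le_trans _ _ (\sum_(0 <= j < J) (c j)%:E)%E).
  apply: lee_sum => j _; rewrite /V /c; case: pickle_inv => /= [w|]; last first.
    by rewrite /diam_pow eqxx.
  by case: ifP => // _; rewrite /diam_pow eqxx.
rewrite sumEFin lee_fin -(big_pmap _ (fun w => if (N <= size w)%N then b w else 0)).
rewrite -big_mkcond/=.
have us : uniq (pmap (@pickle_inv (seq A)) (index_iota 0 J)).
  by rewrite (pmap_uniq pickle_invK)// iota_uniq.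
set l := pmap _ _ in us *.
pose K := (\max_(w <- l) size w).+1.
apply: (le_trans (uniq_sum_by_size (K := K) N b0 us _)).
  by move=> w wl; rewrite /K ltnS; apply: leq_bigmax_seq.
apply: (@le_trans _ _ (\sum_(N <= n < K) q ^+ n)).
  rewrite big_nat [leRHS]big_nat; apply: ler_sum => n /andP[Nn _].
  by apply: bq; apply: leq_trans Nn; rewrite /N; lia.
have [KN|NK] := leqP K N.
  by rewrite big_geq// divr_ge0 ?exprn_ge0// ltW.
rewrite -(subnKC (ltnW NK)) geometric_partial_tail.
by apply: geometric_le_lim => //; rewrite exprn_ge0// ltW.
Unshelve. all: by end_near. Qed.

(** * Lower bounds for the measure of coded Cantor sets *)

Section Cantor.
Context (Om : finType) (l : Om -> R) (F : (nat -> Om) -> T) (b c s : R).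
Let lam (w : seq Om) : R := \sum_(o <- w) l o.
Let mass (w : seq Om) : R := expR (s * lam w).
Hypothesis c0 : 0 < c.
Hypothesis s0 : 0 < s.
Hypothesis l_bounds : forall o, - b <= l o <= - c.
Hypothesis l_sum : 1 <= \sum_o expR (s * l o).
Hypothesis F_sep : forall x y k, mkseq x k = mkseq y k -> x k <> y k ->
  expR (lam (mkseq x k.+1)) <= d (F x) (F y).

Let lam_rcons w o : lam (rcons w o) = lam w + l o.
Proof. by rewrite /lam -cats1 big_cat big_seq1. Qed.

Let mass_small (x : nat -> Om) e : 0 < e -> exists k, mass (mkseq x k) <= e.
Proof.
move=> e0; pose q := expR (- (s * c)).
have q1 : `|q| < 1 by rewrite ger0_norm ?expR_ge0// expR_lt1 oppr_lt0 mulr_gt0.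
have /cvgrPdist_lt/(_ _ e0) [k _ /(_ k (leqnn k))] := @cvg_expr R q q1.
rewrite sub0r normrN ger0_norm ?exprn_ge0 ?expR_ge0// => /ltW qk.
exists k; apply: le_trans qk; rewrite /q -expRM_natl ler_expR.
elim: k => [|k IH]; first by rewrite /lam /mkseq big_nil mulr0 mul0r.
rewrite mkseqS lam_rcons -natr1 mulrDl mul1r mulrDr lerD// -mulrN ler_pM2l//.
by case/andP: (l_bounds (x k)).
Qed.

(** A first disagreement with [x0] at index [j - 1] would, by [F_sep], make the diameter at least
    the scale of the prefix of length [j]. *)
Let common_prefix (U : set T) (x0 : nat -> Om) m : U (F x0) ->
  (forall j, (j <= m)%N -> (0 < j)%N -> ~ ((expR (lam (mkseq x0 j)))%:E <= diam d U)%E) ->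
  forall x, U (F x) -> mkseq x m = mkseq x0 m.
Proof.
move=> Ux0 h x Ux; elim: m h => [//|m IH] h.
have e : mkseq x m = mkseq x0 m by apply: IH => j jm; apply: h; exact: leqW.
rewrite !mkseqS e; congr rcons; apply: contrapT => ne.
apply: (h m.+1) => //; apply: (le_trans _ (dist_le_diam Ux0 Ux)).
by rewrite lee_fin F_sep//; exact: nesym.
Qed.

(** A cover set sees the Cantor set inside one cylinder of comparable mass. The error [e] serves the
    sets that contain no coded point or whose diameter is below every scale; there a very long word
    is taken. *)
Let capture (U : set T) e : 0 < e -> exists w,
  (forall x, U (F x) -> mkseq x (size w) = w) /\
  ((mass w)%:E <= (expR (s * b))%:E * diam_pow d s U + e%:E)%E.
Proof.
move=> e0.
have rhs_ge0 : (0 <= (expR (s * b))%:E * diam_pow d s U)%E.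
  by rewrite mule_ge0 ?diam_pow_ge0// lee_fin expR_ge0.
have small x : exists k, ((mass (mkseq x k))%:E <=
    (expR (s * b))%:E * diam_pow d s U + e%:E)%E.
  have [k hk] := mass_small x e0; exists k.
  by rewrite -[leLHS]add0e leeD// lee_fin.
have [[x0 Ux0]|noU] := pselect (exists x, U (F x)); last first.
  have [a _|Om0] := pickP (fun _ : Om => true); last first.
    by move: l_sum; rewrite big1 ?ler10// => o; have := Om0 o.
  have [k hk] := small (fun=> a); exists (mkseq (fun=> a) k); split=> // x Ux.
  by case: noU; exists x.
have [ex|nex] := pselect (exists k, ((expR (lam (mkseq x0 k)))%:E <= diam d U)%E); last first.
  have [k hk] := small x0; exists (mkseq x0 k); split=> // x Ux; rewrite size_mkseq.
  by apply: common_prefix Ux => // j _ _ hj; apply: nex; exists j.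
(* The last letter of the shortest prefix with scale at most the diameter is dropped, which costs at
   most the factor [expR (s * b)]. For [k = 0] the word is empty, and [b >= c > 0] makes that factor
   at least 1. *)
case: (ex_minnP ex) => k hk kmin; exists (mkseq x0 k.-1); split.
  move=> x Ux; rewrite size_mkseq; apply: common_prefix Ux => // j jk j0 /kmin kj.
  by lia.
rewrite -[leLHS]adde0 leeD ?lee_fin ?(ltW e0)//.
have Une : U !=set0 by exists (F x0).
rewrite diam_pow_nonempty//.
apply: (@le_trans _ _ (expR (s * b) * expR (lam (mkseq x0 k)) `^ s)%:E).
  rewrite lee_fin -expRM -expRD ler_expR [lam _ * s]mulrC -mulrDr ler_pM2l//.
  case: k {hk kmin} => [|k]; last first.
    rewrite mkseqS lam_rcons /=; have /andP[] := l_bounds (x0 k).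
    by move=> *; lra.
  have /andP[] := l_bounds (x0 0%N); move=> h1 h2; rewrite /= lerDr.
  by move: h1 h2 c0; move: (l _) => p h1 h2 h3; lra.
rewrite EFinM lee_pmul2l ?lte_fin ?expR_gt0//.
rewrite -poweR_EFin; apply: gt0_ler_poweR => //; first exact: ltW.
- by rewrite in_itv/= lee_fin expR_ge0 leey.
- by rewrite in_itv/= leey (diam_ge0 Une).
Qed.

(** Let [f v] be the total mass of the [w i] that extend [v]. The invariant [f v < mass v] passes to
    some child, since by [l_sum] the masses of the children add up to at least [mass v]. It fails at
    every [w i], so the branch never meets them. *)
Let escape (w : nat -> seq Om) : (\sum_(0 <= i <oo) (mass (w i))%:E < 1)%E ->
  exists x, forall i, mkseq x (size (w i)) <> w i.
Proof.
move=> w1.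
pose f v := (\sum_(0 <= i <oo) (if prefix v (w i) then (mass (w i))%:E else 0))%E.
have t0 v i : (0 <= (if prefix v (w i) then (mass (w i))%:E else 0) :> \bar R)%E.
  by case: ifP => // _; rewrite lee_fin expR_ge0.
have [| |x xP] := @infinite_branch Om (fun v => (f v < (mass v)%:E)%E).
- rewrite /mass /lam big_nil mulr0 expR0; apply: le_lt_trans w1.
  by apply: lee_nneseries => i *; [exact: t0|rewrite /= prefix0s].
- move=> v fv; apply: contrapT => /forallNP h.
  have : (f v < \sum_o f (rcons v o))%E.
    apply: (lt_le_trans fv).
    apply: (@le_trans _ _ (\sum_o (mass (rcons v o))%:E)%E); last first.
      by apply: lee_sum => o _; rewrite leNgt; apply/negP.
    rewrite sumEFin lee_fin.
    under eq_bigr do rewrite /mass lam_rcons mulrDr expRD.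
    by rewrite -mulr_sumr ler_peMr ?expR_ge0.
  rewrite ltNge => /negP; apply.
  rewrite /f -nneseries_sum//.
  apply: lee_nneseries => [i _ _|i _]; first by apply: sume_ge0.
  have [/prefixP[t wt]|npre] := boolP (prefix v (w i)); last first.
    rewrite big1// => o _; case: ifP => // /prefixP[t wt]; case/prefixP: npre.
    by exists (o :: t); rewrite wt cat_rcons.
  rewrite -big_mkcond/=.
  (* If [w i] is [v] itself, no child counts it; otherwise only the child along its next letter
     does. *)
  case: t wt => [|o t] wt.
    rewrite big_pred0 ?lee_fin ?expR_ge0// => o.
    apply/negP => /prefixP[t]; rewrite wt cats0 => /(congr1 size).
    by rewrite size_cat size_rcons; lia.
  rewrite (big_pred1 o)// => o'; rewrite wt -cats1.
  by rewrite prefix_catr// eqxx prefix_cons prefix0s andbT.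
exists x => i xi; have := xP (size (w i)); rewrite xi.
rewrite ltNge => /negP; apply; rewrite /f.
apply: (le_trans _ (nneseries_lim_ge i.+1 _)) => //.
rewrite big_nat_recr//= prefix_refl leeDr//.
by apply: sume_ge0.
Qed.

(* Mass distribution principle for the weights [mass]; instead of a measure, a
   branch escaping a light cover is built letter by letter. *)
Lemma cantor_measure_neq0 (E : set T) : range F `<=` E ->
  hausdorff_measure d s E <> 0%E.
Proof.
move=> FE /hausdorff_measure_eq0P E0.
(* The captured words must have total mass below 1: one half is left to the cover, after the factor
   [expR (s * b)], and one half to the errors, which are summed geometrically. *)
have eta0 : 0 < expR (- (s * b)) / 2 by rewrite divr_gt0// expR_gt0.
have [U [EU _ sU]] := E0 1 _ ltr01 eta0.
have e0 i : 0 < 2^-1 / (2 ^ i.+1)%:R :> R by rewrite divr_gt0// ltr0n expn_gt0.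
have [w wP] := choice (fun i => capture (U i) (e0 i)).
have [|x xw] := @escape w.
  apply: (@le_lt_trans _ _ (\sum_(0 <= i <oo) ((expR (s * b))%:E * diam_pow d s (U i)
      + (2^-1 / (2 ^ i.+1)%:R)%:E))%E).
    apply: lee_nneseries => i *; first by rewrite lee_fin expR_ge0.
    by case: (wP i).
  have ge0 i : (0 <= (expR (s * b))%:E * diam_pow d s (U i))%E.
    by rewrite mule_ge0 ?diam_pow_ge0// lee_fin expR_ge0.
  apply: (le_lt_trans (epsilon_trick xpredT ge0 _)); first by rewrite invr_ge0.
  rewrite nneseriesZl; last by move=> *; exact: diam_pow_ge0.
  have -> : 1%E = ((2^-1)%:E + (2^-1)%:E)%E :> \bar R.
    by rewrite -EFinD; congr EFin; lra.
  rewrite lteD2rE//.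
  rewrite -lte_pdivlMl ?expR_gt0// -expRN -EFinM.
  exact: sU.
have [i _ Ui] := EU _ (FE _ (imageT F x)).
by case: (xw i); case: (wP i) => + _; apply.
Qed.

End Cantor.
End Hausdorff.

(** * Cylinders, Birkhoff sums and bounded distortion *)

Section Symbolic.
Context {R : realType} {A : finType} {M : rel A}.
Implicit Types (f : sft M -> R) (xi eta : sft M) (w : seq A).

Lemma iter_shiftE (k : nat) xi (i : nat) : (iter k shift xi) i = xi (k + i)%N.
Proof. by elim: k i => [//|k IH] i; rewrite iterS /= IH addnS. Qed.

Lemma prefix_of_eqP xi eta n :
  prefix_of xi n = prefix_of eta n <-> forall i, (i < n)%N -> xi i = eta i.
Proof.
split=> [e i lti|e]; last first.
  by apply/eq_in_map => i; rewrite mem_iota => /andP[_]; exact: e.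
by rewrite -(nth_mkseq (xi 0%N) xi lti) -(nth_mkseq (xi 0%N) eta lti); congr nth.
Qed.

Lemma prefix_ofD xi m n :
  prefix_of xi (m + n) = prefix_of xi m ++ prefix_of (iter m shift xi) n.
Proof.
rewrite /prefix_of /mkseq iotaD map_cat add0n -[X in iota X n](addn0 m) iotaDl -map_comp.
by congr cat; apply: eq_map => i /=; rewrite iter_shiftE.
Qed.

Lemma cylinder_prefix_of xi n : cylinder (prefix_of xi n) xi.
Proof. by rewrite /cylinder /= size_mkseq. Qed.

Lemma cylinder_mkseq (x : nat -> A) n xi :
  cylinder (mkseq x n) xi <-> forall i, (i < n)%N -> xi i = x i.
Proof.
change (prefix_of xi (size (mkseq x n)) = mkseq x n <-> forall i, (i < n)%N -> xi i = x i).
rewrite size_mkseq; split=> [e i lti|e]; last first.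
  by apply/eq_in_map => i; rewrite mem_iota => /andP[_]; exact: e.
by rewrite -(nth_mkseq (x 0%N) xi lti) -(nth_mkseq (x 0%N) x lti); congr nth.
Qed.

Lemma cylinder_cat w w' xi : cylinder (w ++ w') xi <->
  cylinder w xi /\ cylinder w' (iter (size w) shift xi).
Proof.
rewrite /cylinder /= size_cat prefix_ofD; split=> [/eqP|[-> ->]//].
by rewrite eqseq_cat ?size_mkseq// => /andP[/eqP ? /eqP ?].
Qed.

Lemma cylinder_eq w xi eta : cylinder w xi -> cylinder w eta ->
  prefix_of xi (size w) = prefix_of eta (size w).
Proof. by rewrite /cylinder /= => -> ->. Qed.

Lemma cylinder_path a w xi : cylinder w xi -> M a (xi 0%N) -> path M a w.
Proof.
move=> <-; elim: (size w) a xi => [//|n IH] a xi aM.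
rewrite -add1n prefix_ofD /= aM; apply: IH; exact: sft_adm.
Qed.

Lemma birkhoffD m n f xi :
  birkhoff (m + n) f xi = birkhoff m f xi + birkhoff n f (iter m shift xi).
Proof.
rewrite /birkhoff big_split_ord/=; congr (_ + _); apply: eq_bigr => k _.
by rewrite addnC iterD.
Qed.

Lemma birkhoff_norm_le f B n xi : (forall eta, `|f eta| <= B) ->
  `|birkhoff n f xi| <= n%:R * B.
Proof.
move=> fB; apply: (le_trans (ler_norm_sum _ _ _)).
by apply: (le_trans (ler_sum _ (fun k _ => fB _))); rewrite sumr_const card_ord mulr_natl.
Qed.

Lemma birkhoff_ge f c n xi : (forall eta, c <= f eta) ->
  n%:R * c <= birkhoff n f xi.
Proof.
move=> fc; apply: (le_trans _ (ler_sum _ (fun k _ => fc _))).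
by rewrite sumr_const card_ord mulr_natl.
Qed.

Lemma birkhoffN n f xi : birkhoff n (\- f) xi = - birkhoff n f xi.
Proof. by rewrite /birkhoff sumrN. Qed.

Lemma birkhoff_lin n f g a xi :
  birkhoff n (fun x => f x - a * g x) xi = birkhoff n f xi - a * birkhoff n g xi.
Proof. by rewrite /birkhoff mulr_sumr -sumrB. Qed.

Lemma hoelder_modulus f : hoelder_continuous f ->
  exists C q : R, [/\ 0 <= C, 0 < q < 1 & forall n xi eta,
    prefix_of xi n = prefix_of eta n -> `|f xi - f eta| <= C * q ^+ n].
Proof.
(* The sign of [C] is not prescribed, hence the absolute value. *)
move=> [theta [C [theta0 fC]]]; exists `|C|, (expR (- theta)); split=> //.
  by rewrite expR_gt0 expR_lt1 oppr_lt0.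
move=> n xi eta e; have [->|ne] := pselect (xi = eta).
  by rewrite subrr normr0 mulr_ge0// exprn_ge0// expR_ge0.
apply: (le_trans (fC xi eta)); apply: (le_trans (ler_norm _)).
rewrite normrM ler_wpM2l// ger0_norm ?powR_ge0//.
have -> : dist1 xi eta = expR (- (size (wedge xi eta))%:R) :> R.
  by rewrite /dist1; case: (pselect (xi = eta)).
rewrite -expRM -expRM_natl ler_expR mulrN mulNr lerN2 ler_wpM2r ?(ltW theta0)// ler_nat.
by apply/wedge_longest.
Qed.

Lemma hoelder_bounded f : hoelder_continuous f ->
  exists2 B, 0 <= B & forall xi, `|f xi| <= B.
Proof.
move=> /hoelder_modulus[C [q [C0 _ h]]].
have [[xi0 _]|none] := pselect (exists xi : sft M, True); last first.
  by exists 0 => // xi; case: none; exists xi.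
exists (`|f xi0| + C) => [|xi]; first by rewrite addr_ge0.
rewrite -[f xi](subrK (f xi0)) addrC (le_trans (ler_normD _ _))// lerD2l.
by apply: (le_trans (h 0%N _ _ _)) => //; rewrite expr0 mulr1.
Qed.

Definition distortion_le f V := forall n xi eta,
  prefix_of xi n = prefix_of eta n -> `|birkhoff n f xi - birkhoff n f eta| <= V.

(** After [k] shifts the two points still share [n - k] letters, so the differences are dominated by
    a geometric series. *)
Lemma hoelder_distortion f : hoelder_continuous f ->
  exists2 V, 0 <= V & distortion_le f V.
Proof.
move=> /hoelder_modulus[C [q [C0 /andP[q0 q1] h]]].
have q1' : 0 < 1 - q by rewrite subr_gt0.
exists (C / (1 - q)) => [|n xi eta e]; first by rewrite divr_ge0// ltW.
rewrite /birkhoff -sumrB; apply: (le_trans (ler_norm_sum _ _ _)).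
apply: (@le_trans _ _ (\sum_(k < n) C * q ^+ (n - k))).
  apply: ler_sum => k _; apply: h; apply/prefix_of_eqP => i lti.
  rewrite !iter_shiftE; have /prefix_of_eqP := e; apply; have := ltn_ord k; lia.
rewrite (reindex_inj rev_ord_inj)/=.
apply: (@le_trans _ _ (series (geometric C q) n)); last first.
  by apply: geometric_le_lim => //; rewrite ger0_norm// ltW.
rewrite /series /geometric /= big_mkord; apply: ler_sum => k _.
rewrite ler_wpM2l// ler_wiXn2l ?(ltW q0) ?(ltW q1)//=; have := ltn_ord k; lia.
Qed.

Lemma distortion_lin f g a V V' : distortion_le f V -> distortion_le g V' ->
  distortion_le (fun x => f x - a * g x) (V + `|a| * V').
Proof.
move=> fV gV n xi eta e; rewrite !birkhoff_lin.
have -> : birkhoff n f xi - a * birkhoff n g xi - (birkhoff n f eta - a * birkhoff n g eta) =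
  (birkhoff n f xi - birkhoff n f eta) - a * (birkhoff n g xi - birkhoff n g eta) by ring.
apply: (le_trans (ler_normB _ _)); rewrite normrM lerD ?ler_wpM2l//.
- exact: fV.
- exact: gV.
Qed.

Lemma finite_pos_lower_bound (I : finType) (c : I -> R) : (forall i, 0 < c i) ->
  exists2 m, 0 < m & forall i, m <= c i.
Proof.
(* This formula replaces the minimum and also makes sense for an empty index type. *)
move=> c0; exists (1 + \sum_i (c i)^-1)^-1 => [|i].
  by rewrite invr_gt0 ltr_wpDr// sumr_ge0// => i _; rewrite invr_ge0 ltW.
rewrite -[leRHS]invrK lef_pV2 ?posrE ?invr_gt0 ?c0//; last first.
  by rewrite ltr_wpDr// sumr_ge0// => j _; rewrite invr_ge0 ltW.
rewrite (bigD1 i)//= [1 + _]addrC -addrA lerDl addr_ge0// sumr_ge0// => j _.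
by rewrite invr_ge0 ltW.
Qed.

(** Compactness in tree form: if [f] has no positive lower bound, then some branch consists of words
    on whose cylinders [f] gets arbitrarily small, and continuity contradicts positivity at the
    limit point [y]. *)
Lemma hoelder_pos_lower_bound f : hoelder_continuous f -> (forall xi, 0 < f xi) ->
  exists2 c, 0 < c & forall xi, c <= f xi.
Proof.
move=> /hoelder_modulus[C [q [C0 /andP[q0 q1] h]]] f0; apply: contrapT => noc.
pose P w := forall c, 0 < c -> exists2 xi, cylinder w xi & f xi < c.
have [| |x xP] := @infinite_branch A P.
- move=> c c0; apply: contrapT => nxi; apply: noc; exists c => // xi.
  by rewrite leNgt; apply/negP => fc; apply: nxi; exists xi.
- move=> w Pw; apply: contrapT => /forallNP na.
  have /choice[c cP] a : exists c, 0 < c /\ forall xi, cylinder (rcons w a) xi -> c <= f xi.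
    apply: contrapT => nc; apply: (na a) => c c0; apply: contrapT => nxi.
    apply: nc; exists c; split=> // xi wxi; rewrite leNgt; apply/negP => fc.
    by apply: nxi; exists xi.
  have [m m0 mc] := finite_pos_lower_bound (fun a => (cP a).1).
  have [xi wxi] := Pw m m0; rewrite ltNge => /negP; apply.
  apply: (le_trans (mc (xi (size w)))); apply: (cP _).2.
  by rewrite /cylinder /= size_rcons /prefix_of mkseqS -/(prefix_of _ _) wxi.
have xM i : M (x i) (x i.+1).
  have [xi xix _] := xP i.+2 1 ltr01.
  have /cylinder_mkseq e := xix.
  by rewrite -(e i)// -(e i.+1)//; exact: sft_adm.
pose y := Sft xM.
have qn1 : `|q| < 1 by rewrite ger0_norm// ltW.
(* With this threshold the oscillation [C * q ^+ k] is below half of [f y]; adding 1 covers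
   [C = 0]. *)
have e0 : 0 < f y / 2 / (C + 1) by rewrite !divr_gt0// ltr_wpDl.
have /cvgrPdist_lt/(_ _ e0) [k _ /(_ k (leqnn k))] := @cvg_expr R q qn1.
rewrite sub0r normrN ger0_norm ?exprn_ge0 ?(ltW q0)// ltr_pdivlMr ?ltr_wpDl// => qk.
have [xi xix fxi] := xP k _ (divr_gt0 (f0 y) (ltr0Sn _ 1)).
have : `|f y - f xi| <= C * q ^+ k.
  have /cylinder_mkseq e := xix.
  by apply: h; apply/prefix_of_eqP => i ik; rewrite e.
have qk0 : 0 < q ^+ k by rewrite exprn_gt0.
move=> /(le_trans (ler_norm _)); nra.
Qed.

Section WordSup.
Context (f : sft M -> R) (B : R).
Hypothesis fB : forall xi, `|f xi| <= B.

Lemma le_word_sup w xi : cylinder w xi -> birkhoff (size w) f xi <= word_sup w f.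
Proof.
move=> wxi; apply: ub_le_sup; last by exists xi.
exists ((size w)%:R * B) => _ [eta _ <-].
by apply: (le_trans (ler_norm _)); exact: birkhoff_norm_le.
Qed.

Lemma word_sup_le w c : cylinder (M := M) w !=set0 ->
  (forall xi, cylinder w xi -> birkhoff (size w) f xi <= c) -> word_sup w f <= c.
Proof.
move=> [xi wxi] h; apply: ge_sup; first by exists (birkhoff (size w) f xi); exists xi.
by move=> _ [eta weta <-]; exact: h.
Qed.

Lemma word_sup_distortion V w xi : distortion_le f V -> cylinder w xi ->
  word_sup w f <= birkhoff (size w) f xi + V.
Proof.
move=> fV wxi; apply: word_sup_le; first by exists xi.
move=> eta weta; rewrite -lerBlDl; apply: (le_trans (ler_norm _)).
by apply: fV; exact: cylinder_eq.
Qed.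

End WordSup.
End Symbolic.

(** * Diameter and separation estimates for [dist_u] *)

Section Metric.
Context {R : realType} {A : finType} {M : rel A} (u : sft M -> R) (B : R).
Hypothesis uB : forall xi, `|u xi| <= B.
Hypothesis u0 : forall xi, 0 < u xi.

Let NuB xi : `|(\- u) xi| <= B.
Proof. by rewrite /= normrN. Qed.

Lemma dist_u_xx xi : dist_u u xi xi = 0.
Proof. by rewrite /dist_u; case: (pselect (xi = xi)). Qed.

Lemma dist_u_neq xi eta : xi <> eta ->
  dist_u u xi eta = expR (word_sup (M := M) (wedge xi eta) (\- u)).
Proof. by rewrite /dist_u; case: (pselect (xi = eta)). Qed.

Lemma dist_u_ge0 xi eta : 0 <= dist_u u xi eta.
Proof.
by have [->|ne] := pselect (xi = eta); rewrite ?dist_u_xx ?dist_u_neq ?expR_ge0.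
Qed.

Lemma le_birkhoff m n xi : (m <= n)%N -> birkhoff m u xi <= birkhoff n u xi.
Proof.
move=> /subnKC <-; rewrite birkhoffD lerDl.
by apply: sumr_ge0 => k _; exact: ltW.
Qed.

Lemma dist_u_cylinder_le w xi eta : cylinder w xi -> cylinder w eta ->
  dist_u u xi eta <= expR (word_sup (M := M) w (\- u)).
Proof.
move=> wxi weta; have [<-|ne] := pselect (xi = eta).
  by rewrite dist_u_xx expR_ge0.
rewrite dist_u_neq//.
have sw : (size w <= size (wedge xi eta))%N.
  by apply/(wedge_longest _ ne); exact: cylinder_eq.
rewrite ler_expR; apply: word_sup_le.
  by exists xi; rewrite /wedge; exact: cylinder_prefix_of.
move=> z wz; apply: (@le_trans _ _ (birkhoff (size w) (\- u) z)).
  by rewrite !birkhoffN lerN2 le_birkhoff.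
apply: le_word_sup NuB _ _ _.
apply: esym; rewrite -[LHS]wxi; apply/prefix_of_eqP => i iw.
have : prefix_of z (size (wedge xi eta)) = prefix_of xi (size (wedge xi eta)).
  by apply: cylinder_eq wz _; rewrite /wedge; exact: cylinder_prefix_of.
by move=> /prefix_of_eqP ->//; exact: leq_trans sw.
Qed.

(** The common prefix is shorter than [n]; as [u] is positive, cutting the sum there only increases
    the sum of [\- u]. *)
Lemma dist_u_ge n xi eta : prefix_of xi n <> prefix_of eta n ->
  expR (- birkhoff n u xi) <= dist_u u xi eta.
Proof.
move=> pn; have ne : xi <> eta by move=> e; rewrite e in pn.
rewrite dist_u_neq//.
have nw : (size (wedge xi eta) < n)%N.
  by rewrite ltnNge; apply/negP => /(wedge_longest _ ne).
rewrite ler_expR; apply: (@le_trans _ _ (birkhoff (size (wedge xi eta)) (\- u) xi)).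
  by rewrite birkhoffN lerN2 le_birkhoff// ltnW.
by apply: (le_word_sup NuB); rewrite /wedge; exact: cylinder_prefix_of.
Qed.

End Metric.

(** * Loops at a letter and limits of concatenated blocks *)

Section Concatenation.
Context {A : finType} {M : rel A}.

(** The initial [a] is not part of the word but the final one is, so loops concatenate freely. *)
Definition returns (a : A) (w : seq A) := path M a w && (last a w == a).

Lemma returns_cat a w w' : returns a w -> returns a w' -> returns a (w ++ w').
Proof.
move=> /andP[pw /eqP lw] /andP[pw' lw'].
by rewrite /returns cat_path last_cat lw pw pw' lw'.
Qed.

Lemma returns_wpow a w l : returns a w -> returns a (wpow w l).
Proof.
by move=> rw; elim: l => [|l IH]; [rewrite /returns /= eqxx|exact: returns_cat].
Qed.

Lemma size_wpow (w : seq A) l : size (wpow w l) = (l * size w)%N.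
Proof. by rewrite /wpow size_flatten /shape map_nseq sumn_nseq mulnC. Qed.

Lemma nth_wpow (a : A) w l i : (i < l * size w)%N ->
  nth a (wpow w l) i = nth a w (i %% size w).
Proof.
elim: l i => [//|l IH] i il; rewrite /wpow /= -/(wpow w l) nth_cat.
case: ltnP => wi; first by rewrite modn_small.
rewrite IH; last by rewrite ltn_subLR// -mulSn.
by rewrite -{2}(subnK wi) modnDr.
Qed.

Section Limit.
Context (a0 : A) (Om : Type) (block : seq A -> Om -> seq A).

(** A block may depend on the whole word built so far; this lets a corrector react to the
    accumulated sum. *)
Fixpoint concat (x : nat -> Om) (k : nat) : seq A :=
  if k is j.+1 then concat x j ++ block (concat x j) (x j) else [::].

Hypothesis block_returns : forall w o, returns a0 (block w o).
Hypothesis block_neq0 : forall w o, (0 < size (block w o))%N.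

Lemma eq_concat x y k : mkseq x k = mkseq y k -> concat x k = concat y k.
Proof.
elim: k => [//|k IH]; rewrite !mkseqS => /rcons_inj[e xk] /=.
by rewrite (IH e) xk.
Qed.

Lemma concat_returns x k : returns a0 (concat x k).
Proof.
by elim: k => [|k IH]; [rewrite /returns /= eqxx|apply: returns_cat].
Qed.

Lemma size_concat_ge x k : (k <= size (concat x k))%N.
Proof.
elim: k => [//|k IH] /=; rewrite size_cat.
by have := block_neq0 (concat x k) (x k); lia.
Qed.

Lemma concat_prefix x j k : (j <= k)%N -> prefix (concat x j) (concat x k).
Proof.
move=> /subnKC <-; elim: (k - j)%N => [|m IH]; first by rewrite addn0 prefix_refl.
by rewrite addnS /= prefix_catl.
Qed.

Lemma nth_concat x j k i : (i < size (concat x j))%N -> (i < size (concat x k))%N ->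
  nth a0 (concat x j) i = nth a0 (concat x k) i.
Proof.
wlog jk : j k / (j <= k)%N => [h|] ij ik.
  by case: (leqP j k) => [|/ltnW] jk; [exact: h|apply/esym/h].
by have /prefixP[t ->] := concat_prefix x jk; rewrite nth_cat ij.
Qed.

Lemma concat_limit : exists F : (nat -> Om) -> sft M,
  forall x k, cylinder (concat x k) (F x).
Proof.
suff h x : exists xi : sft M, forall k, cylinder (concat x k) xi.
  by have [F FP] := choice h; exists F.
(* Blocks are nonempty, so stage [i.+1] already has a letter at index [i], and later stages keep
   it. *)
pose y i := nth a0 (concat x i.+1) i.
have yM i : M (y i) (y i.+1).
  have i2 := size_concat_ge x i.+2.
  have -> : y i = nth a0 (concat x i.+2) i.
    by apply: nth_concat; [exact: size_concat_ge|exact: ltnW].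
  have /andP[/(pathP a0) h _] := concat_returns x i.+2.
  by have := h i.+1 i2.
exists (Sft yM) => k.
have -> : concat x k = mkseq y (size (concat x k)).
  apply: (@eq_from_nth _ a0); first by rewrite size_mkseq.
  move=> i ik; rewrite nth_mkseq//; apply: nth_concat => //.
  exact: size_concat_ge.
by apply/cylinder_mkseq.
Qed.

Lemma concat_bracket x m : exists k,
  (size (concat x k) <= m < size (concat x k.+1))%N.
Proof.
have ex : exists k, (m < size (concat x k))%N by exists m.+1; exact: size_concat_ge.
case: (ex_minnP ex) => -[//|k] hk kmin; exists k; rewrite hk andbT leqNgt.
by apply/negP => /kmin; rewrite ltnn.
Qed.

End Limit.

(** Connectors depend only on the end letters of the word, so finiteness of the alphabet bounds
    their lengths by one [L]. *)
Lemma return_connectors (a0 : A) : topologically_transitive M ->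
  exists (e1 e2 : A -> seq A) (L : nat),
    (forall a, (size (e1 a) <= L)%N /\ (size (e2 a) <= L)%N) /\
    forall w, w != [::] -> admissible M w ->
      returns a0 (e1 (head a0 w) ++ w ++ e2 (last a0 w)).
Proof.
move=> tr; have h (p : A * A) : exists rho, admissible M (p.1 :: rcons rho p.2) by exact: tr.
have [rho rhoP] := choice h.
exists (fun a => rho (a0, a)), (fun a => rcons (rho (a, a0)) a0).
exists (\max_(p : A * A) size (rho p)).+1; split.
  move=> a; rewrite size_rcons ltnS; split; first apply: leqW.
    exact: (leq_bigmax (a0, a)).
  exact: (leq_bigmax (a, a0)).
case=> [//|b w] _ adm; rewrite /returns /=.
have := rhoP (a0, b); have := rhoP (last b w, a0); rewrite /admissible /= => p1 p2.
rewrite -cat_rcons cat_path last_cat !last_rcons p2 /= cat_path last_cat last_rcons eqxx andbT.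
by rewrite p1 andbT.
Qed.

End Concatenation.

(** * Birkhoff sums along loops and along powers of a word *)

Section Loops.
Context {R : realType} {A : finType} {M : rel A}.
Implicit Types (f : sft M -> R) (xi eta : sft M) (w : seq A) (B V : R).

Lemma birkhoff_cat f w w' xi : birkhoff (size (w ++ w')) f xi =
  birkhoff (size w) f xi + birkhoff (size w') f (iter (size w) shift xi).
Proof. by rewrite size_cat birkhoffD. Qed.

Lemma birkhoff_norm_le_size f B (n L : nat) xi : (forall xi, `|f xi| <= B) ->
  (n <= L)%N -> `|birkhoff n f xi| <= L%:R * B.
Proof.
move=> fB nL; apply: (le_trans (birkhoff_norm_le _ _ fB)).
rewrite ler_wpM2r ?ler_nat//; apply: le_trans (fB xi); exact: normr_ge0.
Qed.

Lemma wpow_birkhoff_ge f w l xi :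
  (forall eta, cylinder w eta -> 1 <= birkhoff (size w) f eta) ->
  cylinder (wpow w l) xi -> l%:R <= birkhoff (size (wpow w l)) f xi.
Proof.
move=> h; elim: l xi => [|l IH] xi; first by rewrite /birkhoff big_ord0.
rewrite /wpow /= -/(wpow w l) => /cylinder_cat[wxi lxi].
by rewrite birkhoff_cat -add1n natrD lerD ?h ?IH.
Qed.

Lemma distortionN f V : distortion_le f V -> distortion_le (\- f) V.
Proof.
by move=> fV n xi eta e; rewrite !birkhoffN -opprD normrN; exact: fV.
Qed.

Lemma admissible_prefix_of xi n : admissible M (prefix_of xi n).
Proof.
case: n => [//|n]; rewrite /admissible -add1n prefix_ofD /=.
by apply: (@cylinder_path _ M) (cylinder_prefix_of _ _) _; exact: sft_adm.
Qed.

(** A prefix with a large sum is closed up to a loop; the two connectors and the distortion cost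
    only a constant. *)
Lemma loop_above f B V (a0 : A) : topologically_transitive M ->
  (forall xi, `|f xi| <= B) -> distortion_le f V ->
  (forall K, exists xi n, K <= birkhoff n f xi) ->
  exists2 P, returns (M := M) a0 P &
    forall xi, cylinder P xi -> 1 <= birkhoff (size P) f xi.
Proof.
move=> tr fB fV unb.
have [e1 [e2 [L [eL er]]]] := return_connectors a0 tr.
(* The absolute value plus 1 makes the target positive, which rules out [n = 0]. *)
have [xi0 [n hn]] := unb (`|1 + L%:R * B + L%:R * B + V| + 1).
have n0 : n != 0%N.
  apply/eqP => n0; move: hn; rewrite n0 /birkhoff big_ord0 leNgt => /negP; apply.
  by rewrite ltr_wpDl.
set w := prefix_of xi0 n.
have w0 : w != [::] by rewrite -size_eq0 size_mkseq.
exists (e1 (head a0 w) ++ w ++ e2 (last a0 w)).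
  by apply: er => //; exact: admissible_prefix_of.
move=> xi /cylinder_cat[_ /cylinder_cat[wxi _]].
rewrite !birkhoff_cat.
set eta := iter _ _ _ in wxi *; set zeta := iter _ _ _.
have h1 := birkhoff_norm_le_size xi fB (eL (head a0 w)).1.
have h2 := birkhoff_norm_le_size zeta fB (eL (last a0 w)).2.
have h3 : `|birkhoff (size w) f xi0 - birkhoff (size w) f eta| <= V.
  by apply: fV; apply: cylinder_eq wxi; exact: cylinder_prefix_of.
have sw : size w = n by rewrite size_mkseq.
rewrite sw in h3 *.
have h4 := ler_norm (1 + L%:R * B + L%:R * B + V).
move: h1 h2 h3; rewrite !ler_norml => /andP[h1 _] /andP[h2 _] /andP[_ h3].
move: (L%:R * B) h1 h2 h4 hn => LB *; lra.
Qed.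

(* On a power of [w] the Birkhoff sums follow those of the periodic point
   [www...], which drift in the direction of the sum over one period. *)
Lemma wpow_birkhoff_one_sided f B V w l xi : (forall xi, `|f xi| <= B) ->
  distortion_le f V -> w <> [::] -> (2 <= l)%N -> cylinder (wpow w l) xi ->
  (forall t m, (t + m <= l * size w)%N ->
    - ((size w)%:R * B + V) <= birkhoff m f (iter t shift xi)) \/
  (forall t m, (t + m <= l * size w)%N ->
    birkhoff m f (iter t shift xi) <= (size w)%:R * B + V).
Proof.
move=> fB fV w0 l2 wxi; set q := size w.
have q0 : (0 < q)%N by rewrite /q; case: w w0 {wxi q}.
have xiE i : (i < l * q)%N -> xi i = nth (xi 0%N) w (i %% q).
  move=> il; rewrite -(nth_wpow _ il) -wxi nth_mkseq ?size_wpow//.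
pose p i := nth (xi 0%N) w (i %% q).
(* Two copies of [w] already contain the transition from its last to its first letter; hence
   [2 <= l]. *)
have pM i : M (p i) (p i.+1).
  have iq : (i %% q < q)%N by rewrite ltn_mod.
  have -> : p i = xi (i %% q)%N by rewrite xiE ?modn_mod//; nia.
  have -> : p i.+1 = xi (i %% q).+1.
    rewrite xiE; last by nia.
    by rewrite -[(i %% q).+1]addn1 modnDml addn1.
  exact: sft_adm.
pose y := Sft pM.
have yq : iter q shift y = y.
  by apply: sft_ext => i; rewrite iter_shiftE /= /p modnDl.
have Sq t : birkhoff q f (iter t shift y) = birkhoff q f y.
  have := birkhoffD t q f y; rewrite addnC birkhoffD yq addrC => /addrI.
  by move=> ->.
have Sqm k t : birkhoff (k * q) f (iter t shift y) = k%:R * birkhoff q f y.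
  elim: k t => [|k IH] t; first by rewrite /birkhoff big_ord0 mul0r.
  by rewrite mulSn birkhoffD Sq -iterD IH -natr1 mulrDl mul1r addrC.
(* Full periods contribute a multiple of the sum over one period, the remainder at most [q%:R * B],
   and the passage from [y] to [xi] at most [V]. *)
have near_y t m : (t + m <= l * q)%N ->
    `|birkhoff m f (iter t shift xi) - (m %/ q)%:R * birkhoff q f y| <= q%:R * B + V.
  move=> tm.
  have h1 : `|birkhoff m f (iter t shift xi) - birkhoff m f (iter t shift y)| <= V.
    apply: fV; apply/prefix_of_eqP => i im; rewrite !iter_shiftE xiE//; lia.
  have h2 : `|birkhoff m f (iter t shift y) - (m %/ q)%:R * birkhoff q f y| <= q%:R * B.
    rewrite {1}(divn_eq m q) birkhoffD Sqm [X in X - _]addrC addrK.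
    by apply: birkhoff_norm_le_size => //; rewrite ltnW// ltn_mod.
  rewrite [leRHS]addrC; apply: (le_trans _ (lerD h1 h2)).
  by apply: (le_trans _ (ler_normD _ _)); rewrite subrKA.
have [Sy|Sy] := lerP 0 (birkhoff q f y); [left|right] => t m /near_y;
  rewrite ler_norml => /andP[h1 h2].
  have : 0 <= (m %/ q)%:R * birkhoff q f y by rewrite mulr_ge0.
  lra.
have : (m %/ q)%:R * birkhoff q f y <= 0 by rewrite mulr_ge0_le0// ltW.
lra.
Qed.

End Loops.

(** * Cantor sets made of good words and correctors *)

Section LoopConcatenation.
Context {R : realType} {A : finType} {M : rel A} (u phi : sft M -> R).
Context (Bu Vu umin Bp Vp D s : R) (a0 a : A) (P N : seq A) (e1 e2 : A -> seq A).
Context (L n j K : nat).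
Hypothesis uB : forall xi, `|u xi| <= Bu.
Hypothesis uV : distortion_le u Vu.
Hypothesis umin0 : 0 < umin.
Hypothesis u_ge : forall xi, umin <= u xi.
Hypothesis phiB : forall xi, `|phi xi| <= Bp.
Hypothesis phiV : distortion_le phi Vp.
Hypothesis P_returns : returns (M := M) a0 P.
Hypothesis N_returns : returns (M := M) a0 N.
Hypothesis P_ge1 : forall xi, cylinder P xi -> 1 <= birkhoff (size P) phi xi.
Hypothesis N_le1 : forall xi, cylinder N xi -> 1 <= birkhoff (size N) (\- phi) xi.
Hypothesis e_size : forall b, (size (e1 b) <= L)%N /\ (size (e2 b) <= L)%N.
Hypothesis e_returns : forall w, w != [::] -> admissible M w ->
  returns (M := M) a0 (e1 (head a0 w) ++ w ++ e2 (last a0 w)).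
Hypothesis n0 : (0 < n)%N.
Hypothesis jK : (j <= K)%N.

Let corr := (size P + size N)%N.
Let len := (L + L + (j + K) * corr)%N.

(** The [K] final loops outweigh everything else in a block: two connectors, the good word and the
    fixed part of the corrector. *)
Hypothesis K_ge : L%:R * Bp + (D + Vp) + L%:R * Bp + (j * corr)%:R * Bp <= K%:R.

Definition good_word (o : seq A) : bool :=
  `[< exists2 xi : sft M, cylinder o xi & `|birkhoff n phi xi| <= D >].

(** With a common first letter all blocks begin with the same [e1 a], so different choices show up
    at the same positions. *)
Let Om := {o : n.-tuple A | good_word o && (head a0 o == a)}.
Let l (o : Om) : R := word_sup (val o) (\- u) - Vu - len%:R * Bu.

Hypothesis s0 : 0 < s.
Hypothesis weight : 1 <= \sum_(o : n.-tuple A | good_word o && (head a0 o == a))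
  expR (s * (word_sup o (\- u) - Vu - len%:R * Bu)).

(** The sign must be decided from the word alone, before the limit point exists; the sum at that
    point differs by at most [Vp]. *)
Let nonneg_sum (w : seq A) : bool :=
  `[< exists2 xi : sft M, cylinder w xi & 0 <= birkhoff (size w) phi xi >].

(* Appending [corrector b] to a good word drives the sum of [phi] down if [b]
   and up otherwise; its first, fixed part [^j] makes every block contain
   stretches of large positive and of large negative sum, which no power of a
   word of [W] does. *)
Let corrector (b : bool) : seq A :=
  if b then wpow P j ++ wpow N K else wpow N j ++ wpow P K.

Let block (w : seq A) (o : Om) : seq A :=
  (e1 a ++ val o) ++ e2 (last a0 (val o)) ++ corrector (nonneg_sum w).

Let Om_good (o : Om) : good_word (val o) /\ head a0 (val o) = a.
Proof. by case/andP: (valP o) => h /eqP. Qed.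

Let Om_cylinder (o : Om) : exists2 xi : sft M, cylinder (val o) xi &
  `|birkhoff n phi xi| <= D.
Proof. by have [/asboolP] := Om_good o. Qed.

Let size_Om (o : Om) : size (val o) = n.
Proof. exact: size_tuple. Qed.

(** A point of the shift space is needed; [weight] excludes an empty sum and so provides a good word
    with a point in its cylinder. *)
Let Bu0 : 0 <= Bu.
Proof.
have [w _|noA] := pickP (fun _ : Om => true).
  by have [xi _ _] := Om_cylinder w; apply: le_trans (uB xi); exact: normr_ge0.
move: weight; rewrite big1 ?ler10// => o ho.
by have := noA (exist _ o ho).
Qed.

Let Vu0 : 0 <= Vu.
Proof.
have [w _|noA] := pickP (fun _ : Om => true).
  have [xi _ _] := Om_cylinder w.
  by apply: le_trans (@uV 0%N xi xi erefl); exact: normr_ge0.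
move: weight; rewrite big1 ?ler10// => o ho.
by have := noA (exist _ o ho).
Qed.

Let corrector_returns b : returns (M := M) a0 (corrector b).
Proof. by case: b; apply: returns_cat; exact: returns_wpow. Qed.

Let block_returns w o : returns (M := M) a0 (block w o).
Proof.
rewrite /block catA; apply: returns_cat => //.
have [xi oxi _] := Om_cylinder o; have [_ ha] := Om_good o.
have w0 : val o != [::] :> seq A by rewrite -size_eq0 size_Om -lt0n.
have wM : admissible M (val o) by rewrite -oxi; exact: admissible_prefix_of.
by have := e_returns w0 wM; rewrite ha -catA.
Qed.

Let size_corrector b : (size (corrector b) <= (j + K) * corr)%N.
Proof. by rewrite /corrector /corr; case: b; rewrite size_cat !size_wpow; clear; nia. Qed.

Let size_block w o : (size (block w o) <= n + len)%N.
Proof.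
rewrite /block !size_cat size_Om /len.
have := size_corrector (nonneg_sum w); have [h1 _] := e_size a.
have [_ h2] := e_size (last a0 (val o)); move: h1 h2; clear; lia.
Qed.

Let block_neq0 w o : (0 < size (block w o))%N.
Proof. by rewrite /block !size_cat size_Om addn_gt0 addn_gt0 n0 orbT. Qed.

Let block_u w o xi : cylinder (block w o) xi ->
  birkhoff (size (block w o)) u xi <= - l o.
Proof.
rewrite /block => /cylinder_cat[/cylinder_cat[_ oxi] _].
rewrite !birkhoff_cat; set eta := iter _ _ _ in oxi *; set zeta := iter _ _ _.
set zeta' := iter _ _ _.
have h0 : word_sup (val o) (\- u) <= birkhoff (size (val o)) (\- u) eta + Vu.
  by apply: (word_sup_distortion _ oxi); exact: distortionN.
have := birkhoff_norm_le_size xi uB (e_size a).1.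
have := birkhoff_norm_le_size zeta uB (e_size (last a0 (val o))).2.
have := birkhoff_norm_le_size zeta' uB (size_corrector (nonneg_sum w)).
move: h0; rewrite birkhoffN /l /len !natrD !ler_norml => h0 /andP[_ h1] /andP[_ h2] /andP[_ h3].
set q := (_ * corr)%:R in h1 *; lra.
Qed.

Let block_phi w o xi : cylinder (block w o) xi ->
  if nonneg_sum w then birkhoff (size (block w o)) phi xi <= 0
  else 0 <= birkhoff (size (block w o)) phi xi.
Proof.
rewrite /block => /cylinder_cat[/cylinder_cat[_ oxi] /cylinder_cat[_ cz]].
rewrite !birkhoff_cat; set eta := iter _ _ _ in oxi *; set zeta' := iter _ _ _ in cz *.
set zeta := iter _ _ _.
have [xi' oxi' xi'D] := Om_cylinder o.
have h0 : `|birkhoff (size (val o)) phi eta - birkhoff (size (val o)) phi xi'| <= Vp.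
  by apply: phiV; apply: cylinder_eq oxi _.
have h1 := birkhoff_norm_le_size xi phiB (e_size a).1.
have h2 := birkhoff_norm_le_size zeta phiB (e_size (last a0 (val o))).2.
rewrite size_Om in h0 *; move: K_ge h0 h1 h2 xi'D; rewrite !ler_norml.
move=> h /andP[h01 h02] /andP[h11 h12] /andP[h21 h22] /andP[h31 h32].
move: cz; rewrite /corrector; case: ifP => _ /cylinder_cat[] pz qz; rewrite birkhoff_cat;
  set z := iter _ _ zeta' in qz *.
- have jp : (size (wpow P j) <= j * corr)%N by rewrite size_wpow leq_mul2l leq_addr orbT.
  have := birkhoff_norm_le_size zeta' phiB jp; rewrite ler_norml => /andP[_ h4].
  have := wpow_birkhoff_ge N_le1 qz; rewrite birkhoffN => h5.
  set q := (_ * corr)%:R in h h4 *; lra.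
- have jp : (size (wpow N j) <= j * corr)%N by rewrite size_wpow leq_mul2l leq_addl orbT.
  have := birkhoff_norm_le_size zeta' phiB jp; rewrite ler_norml => /andP[h4 _].
  have h5 := wpow_birkhoff_ge P_ge1 qz.
  set q := (_ * corr)%:R in h h4 *; lra.
Qed.

Let block_swing w o xi : cylinder (block w o) xi ->
  (exists t m, (t + m <= size (block w o))%N /\ j%:R <= birkhoff m phi (iter t shift xi)) /\
  (exists t m, (t + m <= size (block w o))%N /\ birkhoff m phi (iter t shift xi) <= - j%:R).
Proof.
have jKR : j%:R <= K%:R :> R by rewrite ler_nat.
have Nle k zeta : cylinder (wpow N k) zeta -> birkhoff (size (wpow N k)) phi zeta <= - k%:R.
  by move=> /(wpow_birkhoff_ge N_le1); rewrite birkhoffN lerNr.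
rewrite /block => /cylinder_cat[_ /cylinder_cat[_]]; rewrite -!iterD !size_cat.
rewrite /corrector; case: ifP => _ /cylinder_cat[]; rewrite -iterD => pz qz; split.
- do 2 eexists; split; last exact: (wpow_birkhoff_ge P_ge1 pz).
  by rewrite size_cat; clear; lia.
- do 2 eexists; split; last by apply: (le_trans (Nle _ _ qz)); rewrite lerN2.
  by rewrite size_cat; clear; lia.
- do 2 eexists; split; last by apply: (le_trans jKR); exact: (wpow_birkhoff_ge P_ge1 qz).
  by rewrite size_cat; clear; lia.
- do 2 eexists; split; last exact: (Nle _ _ pz).
  by rewrite size_cat; clear; lia.
Qed.

Section Limit.
Context (F : (nat -> Om) -> sft M).
Hypothesis FP : forall x k, cylinder (concat block x k) (F x).

Let F_block x k :
  cylinder (block (concat block x k) (x k)) (iter (size (concat block x k)) shift (F x)).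
Proof. by have /cylinder_cat[] := FP x k.+1. Qed.

Let F_u x k : birkhoff (size (concat block x k)) u (F x) <=
  - \sum_(o <- mkseq x k) l o.
Proof.
elim: k => [|k IH]; first by rewrite /birkhoff big_ord0 big_nil oppr0.
rewrite mkseqS -cats1 big_cat big_seq1 /= birkhoff_cat opprD lerD//.
exact/block_u/F_block.
Qed.

Lemma concat_separated x y k : mkseq x k = mkseq y k -> x k <> y k ->
  expR (\sum_(o <- mkseq x k.+1) l o) <= dist_u u (F x) (F y).
Proof.
move=> exy nxy; set w := concat block x k.
(* This is the end of the good word in block [k], before its [e2] and corrector, so the prefixes of
   length [m] differ exactly by that good word. *)
pose m := (size w + size (e1 a) + n)%N.
have u_gt0 xi : 0 < u xi by apply: lt_le_trans (u_ge xi).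
have pre z : concat block z k = w -> prefix_of (F z) m = w ++ e1 a ++ val (z k).
  move=> zw; have := FP z k.+1; rewrite /= /block zw.
  rewrite catA => /cylinder_cat[]; rewrite /cylinder /= !size_cat size_Om.
  by rewrite addnA.
apply: (@le_trans _ _ (expR (- birkhoff m u (F x)))); last first.
  apply: (dist_u_ge uB u_gt0); rewrite !pre//; last by apply/esym; exact: eq_concat.
  move=> /eqP; rewrite !eqseq_cat// !eqxx /= => /eqP/val_inj/val_inj.
  exact: nxy.
rewrite ler_expR lerNr; apply: (le_trans _ (F_u x k.+1)); apply: le_birkhoff => //.
rewrite /= size_cat /m -addnA leq_add2l /block -catA catA !size_cat size_Om.
exact: leq_addr.
Qed.

(** At block ends the sum stays within [Vp + E]: each block moves it by at most [E], towards the
    other sign up to the distortion [Vp]. Inside a block it changes by at most another [E]. *)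
Lemma concat_bounded x : exists C : R, forall m, `|birkhoff m phi (F x)| <= C.
Proof.
have Bp0 : 0 <= Bp by apply: le_trans (phiB (F x)); exact: normr_ge0.
have Vp0 : 0 <= Vp by apply: le_trans (@phiV 0%N (F x) (F x) erefl); exact: normr_ge0.
pose E := (n + len)%:R * Bp.
have E0 : 0 <= E by rewrite mulr_ge0.
have nodes k : `|birkhoff (size (concat block x k)) phi (F x)| <= Vp + E.
  elim: k => [|k IH]; first by rewrite /birkhoff big_ord0 normr0 addr_ge0.
  rewrite birkhoff_cat; set w := concat block x k in IH *.
  have := block_phi (F_block x k); rewrite -/w.
  have := birkhoff_norm_le_size (iter (size w) shift (F x)) phiB (size_block w (x k)).
  move: IH; rewrite -/E !ler_norml => /andP[h1 h2] /andP[h3 h4].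
  case: ifPn => [/asboolP[xi wxi xi0]|/asboolPn nex] h5.
    have : `|birkhoff (size w) phi xi - birkhoff (size w) phi (F x)| <= Vp.
      by apply: phiV; apply: (cylinder_eq wxi); exact: FP.
    rewrite ler_norml => /andP[h6 h7]; apply/andP; split; lra.
  have h6 : birkhoff (size w) phi (F x) < 0.
    by rewrite ltNge; apply/negP => h; apply: nex; exists (F x); first exact: FP.
  by apply/andP; split; lra.
exists (Vp + E + E) => m.
have [k /andP[km mk]] := concat_bracket block_neq0 x m.
rewrite -(subnKC km) birkhoffD (le_trans (ler_normD _ _))// lerD//.
apply: birkhoff_norm_le_size => //.
have := size_block (concat block x k) (x k); move: mk; rewrite /= size_cat.
by clear; lia.
Qed.

Lemma concat_avoids (W : set (seq A)) (Q : nat) x :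
  (forall w, W w -> w <> [::]) -> (forall w, W w -> (size w <= Q)%N) ->
  Q%:R * Bp + Vp < j%:R -> avoid_some_power W (F x).
Proof.
(* A stretch of [n + len] letters reaches the next block and as many contain it; the extra 2 ensures
   [2 <= l0]. Both swings of this block then lie inside the power of [w], against its one-sided
   drift. *)
move=> W0 WQ jQ; pose l0 := (2 * (n + len) + 2)%N.
exists l0; first by rewrite /= /l0 addn2.
move=> w Ww [k wk].
have w0 := W0 _ Ww; have sw : (0 < size w)%N by case: (w) w0.
have [k'] : exists k', (k <= size (concat block x k') <= k + (n + len))%N.
  have [i /andP[ik ki]] := concat_bracket block_neq0 x k.
  exists i.+1; rewrite ltnW//= size_cat; apply: leq_add => //; exact: size_block.
set c := concat block x k' => /andP[kc ck].
have [[t [m [tm hi]]] [t' [m' [tm' lo]]]] := block_swing (F_block x k').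
rewrite -/c in tm tm' hi lo.
have sb := size_block c (x k').
have wB : (size w)%:R * Bp <= Q%:R * Bp.
  have Bp0 : 0 <= Bp by apply: le_trans (phiB (F x)); exact: normr_ge0.
  by rewrite ler_wpM2r// ler_nat WQ.
have l2 : (2 <= l0)%N by rewrite /l0 leq_addl.
have split_iter i : iter i shift (iter (size c) shift (F x)) =
    iter (size c - k + i) shift (iter k shift (F x)).
  by rewrite -!iterD addnAC subnK// addnC.
rewrite !split_iter in hi lo.
have fits i p : (i + p <= size (block c (x k')))%N ->
  (size c - k + i + p <= l0 * size w)%N.
  move=> ip; apply: (@leq_trans l0); last exact: leq_pmulr.
  by rewrite /l0; move: ip ck sb; clear; lia.
have [h|h] := wpow_birkhoff_one_sided phiB phiV w0 l2 wk.
- by have := h _ _ (fits _ _ tm'); lra.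
- by have := h _ _ (fits _ _ tm); lra.
Qed.

End Limit.

(** The mass distribution principle is applied with one block per coding letter; its condition on
    the sum of masses is [weight] after reindexing. *)
Lemma uniform_avoiding_measure_neq0 (W : set (seq A)) (Q : nat) :
  (forall w, W w -> w <> [::]) -> (forall w, W w -> (size w <= Q)%N) ->
  Q%:R * Bp + Vp < j%:R ->
  hausdorff_measure (dist_u u) s
    ([set xi | exists C : R, forall m, `|birkhoff m phi xi| <= C] `&` avoid_some_power W)
  <> 0%E.
Proof.
move=> W0 WQ jQ.
have [F FP] := concat_limit block_returns block_neq0.
have u_gt0 xi : 0 < u xi by apply: lt_le_trans (u_ge xi).
apply: (@cantor_measure_neq0 R (sft M) (dist_u u) (dist_u_ge0 u) Om l F
  (n%:R * Bu + Vu + len%:R * Bu) umin s) => //.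
- move=> o; have [xi oxi _] := Om_cylinder o; rewrite /l; apply/andP; split.
    have : birkhoff (size (val o)) (\- u) xi <= word_sup (val o) (\- u).
      by apply: (@le_word_sup _ _ _ _ Bu) => // z; rewrite /= normrN.
    have := birkhoff_norm_le n xi uB; rewrite birkhoffN size_Om ler_norml => /andP[h1 h2] h3.
    by move: (len%:R * Bu) => q; lra.
  have h1 : word_sup (val o) (\- u) <= - umin.
    apply: word_sup_le; first by exists xi.
    move=> z _; rewrite birkhoffN lerN2 size_Om.
    apply: (le_trans _ (birkhoff_ge n z u_ge)).
    by rewrite ler_peMl ?(ltW umin0)// ler1n.
  have : 0 <= len%:R * Bu by rewrite mulr_ge0.
  by move: (len%:R * Bu) Vu0 => q; lra.
- apply: (le_trans weight).
  rewrite (reindex_omap (val : Om -> n.-tuple A) insub)/=; last first.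
    by move=> o ho; rewrite insubT.
  rewrite [leRHS](eq_bigl (fun o : Om =>
    (good_word (val o) && (head a0 (val o) == a)) && (insub (val o) == Some o)))//.
  by move=> o; rewrite (valP o) valK eqxx.
- exact: concat_separated.
- move=> _ [x _ <-]; split; first exact: concat_bounded.
  exact: (concat_avoids FP x W0 WQ jQ).
Qed.

End LoopConcatenation.

(** * Exponential growth of weighted sums over good words *)

Section Pressure.
Context {R : realType} {A : finType} {M : rel A} (u phi : sft M -> R).
Context (Bu Vu umin Bp Vp s t : R).
Hypothesis uB : forall xi, `|u xi| <= Bu.
Hypothesis uV : distortion_le u Vu.
Hypothesis umin0 : 0 < umin.
Hypothesis u_ge : forall xi, umin <= u xi.
Hypothesis phiB : forall xi, `|phi xi| <= Bp.
Hypothesis phiV : distortion_le phi Vp.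
Hypothesis s0 : 0 < s.
Hypothesis st : s < t.

Let u_gt0 xi : 0 < u xi.
Proof. exact: lt_le_trans (u_ge xi). Qed.

Let word_sup_u (w : seq A) : cylinder (M := M) w !=set0 ->
  word_sup (M := M) w (\- u) <= - ((size w)%:R * umin).
Proof.
move=> w0; apply: word_sup_le => // xi _.
by rewrite birkhoffN lerN2; exact: birkhoff_ge.
Qed.

Let good_cylinder n D (w : seq A) : good_word phi D n w -> cylinder (M := M) w !=set0.
Proof. by move=> /asboolP[xi wxi _]; exists xi. Qed.

Definition sublinear_set : set (sft M) := [set xi | forall e, 0 < e ->
  exists N, forall n, (N <= n)%N -> `|birkhoff n phi xi| <= e * n%:R].

(** All long prefixes of a point of the set are good words, and their cylinders have diameter at
    most [expR] of the word sum, so [limsup_cover_null] applies. *)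
Lemma sublinear_set_null (e q : R) (N0 : nat) : 0 < e -> 0 < q < 1 ->
  (forall n, (N0 <= n)%N ->
    \sum_(o : n.-tuple A | good_word phi (e * n%:R) n o)
      expR (t * word_sup (M := M) o (\- u)) <= q ^+ n) ->
  hausdorff_measure (dist_u u) t sublinear_set = 0%E.
Proof.
move=> e0 q01 hq; pose good w := good_word phi (e * (size w)%:R) (size w) w.
have t0 : 0 <= t by rewrite ltW// (lt_trans s0 st).
apply: (@limsup_cover_null R (sft M) (dist_u u) A
  (fun w => if good w then cylinder w else set0)
  (fun w => if good w then expR (t * word_sup (M := M) w (\- u)) else 0) t q _ N0) => //.
- move=> delta delta0.
  have q1 : `|expR (- umin)| < 1 by rewrite ger0_norm ?expR_ge0// expR_lt1 oppr_lt0.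
  have /cvgrPdist_lt/(_ _ delta0) [N _ hN] := @cvg_expr R _ q1.
  exists N => w /hN; rewrite sub0r normrN ger0_norm ?exprn_ge0 ?expR_ge0// => /ltW h.
  case: ifPn => [/good_cylinder w0|_]; apply: diam_le => // xi eta wxi weta.
  apply: (le_trans (dist_u_cylinder_le uB u_gt0 wxi weta)).
  apply: le_trans h; rewrite -expRM_natl ler_expR mulrN; exact: word_sup_u.
- by move=> w; case: ifP => // _; exact: expR_ge0.
- move=> w; case: ifPn => [/good_cylinder w0|_]; last by rewrite /diam_pow eqxx.
  rewrite diam_pow_nonempty// mulrC expRM -poweR_EFin.
  apply: gt0_ler_poweR => //.
  + by rewrite in_itv/= leey (diam_ge0 (dist_u_ge0 u) w0).
  + by rewrite in_itv/= lee_fin expR_ge0 leey.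
  + by apply: diam_le => xi eta wxi weta; exact: (dist_u_cylinder_le uB u_gt0 wxi weta).
- move=> n /hq; apply: le_trans.
  by rewrite [leRHS]big_mkcond/=; apply: ler_sum => o _; rewrite /good size_tuple.
- move=> xi hxi N; have [N' hN'] := hxi _ e0.
  have pxi := cylinder_prefix_of xi (maxn N N').
  exists (prefix_of xi (maxn N N')); first by rewrite size_mkseq leq_maxl.
  suff -> : good (prefix_of xi (maxn N N')) by [].
  rewrite /good size_mkseq; apply/asboolP; exists xi => //.
  by apply: hN'; exact: leq_maxr.
Qed.

(** Passing from exponent [t] to [s] gains [expR (delta * n)]. One third of this pays for the
    threshold [expR (- (delta / 3)) ^+ n], one third for the part of the correctors linear in [n],
    and one third for constants. *)
Lemma avoiding_bounded_null (W : set (seq A)) : topologically_transitive M ->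
  (forall K, exists xi n, K <= birkhoff n phi xi) ->
  (forall K, exists xi n, K <= birkhoff n (\- phi) xi) ->
  finite_set W -> (forall w, W w -> w <> [::]) ->
  hausdorff_measure (dist_u u) s
    ([set xi | exists C : R, forall m, `|birkhoff m phi xi| <= C] `&` avoid_some_power W)
    = 0%E ->
  hausdorff_measure (dist_u u) t sublinear_set = 0%E.
Proof.
move=> tr above below Wfin W0 null.
have [xi0 _] := above 0; pose a0 := xi0 0%N.
have Bp0 : 0 <= Bp by apply: le_trans (phiB xi0); exact: normr_ge0.
have Bu0 : 0 <= Bu by apply: le_trans (uB xi0); exact: normr_ge0.
have Vp0 : 0 <= Vp by apply: le_trans (@phiV 0%N xi0 xi0 erefl); exact: normr_ge0.
have Vu0 : 0 <= Vu by apply: le_trans (@uV 0%N xi0 xi0 erefl); exact: normr_ge0.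
have [P P_ret P_ge1] := loop_above a0 tr phiB phiV above.
have NphiB xi : `|(\- phi) xi| <= Bp by rewrite /= normrN.
have [N N_ret N_ge1] := loop_above a0 tr NphiB (distortionN phiV) below.
have [e1 [e2 [L [eL e_ret]]]] := return_connectors a0 tr.
have [Q hQ] : exists Q : nat, forall w, W w -> (size w <= Q)%N.
  have /finite_seqP[r Wr] := Wfin.
  exists (\max_(w <- r) size w) => w; rewrite Wr => wr; exact: leq_bigmax_seq.
pose j := (Num.truncn (Q%:R * Bp + Vp)).+1.
have jQ : Q%:R * Bp + Vp < j%:R by exact: truncnS_gt.
pose corr := (size P + size N)%N.
pose delta := (t - s) * umin.
have delta0 : 0 < delta by rewrite mulr_gt0// subr_gt0.
pose cB := s * (corr%:R * Bu).
have cB0 : 0 <= cB by rewrite !mulr_ge0// ltW.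
(* [cB] is the price of one more corrector loop, and about [e * n] extra loops are needed. *)
pose e := delta / 3 / (cB + 1).
have e0 : 0 < e by rewrite !divr_gt0// ltr_wpDl.
have cBe : cB * e <= delta / 3.
  by rewrite /e mulrCA ler_piMr ?divr_ge0 ?(ltW delta0)// ler_pdivrMr ?ltr_wpDl// mul1r lerDl.
pose C0 := L%:R * Bp + Vp + L%:R * Bp + (j * corr)%:R * Bp.
have C00 : 0 <= C0 by rewrite !addr_ge0 ?mulr_ge0.
(* This collects the part of the overhead [s * (Vu + len%:R * Bu)] that does not depend on [n]. *)
pose C1 := s * (Vu + (L + L + (j + 1 + j) * corr)%:R * Bu + corr%:R * C0 * Bu).
pose N0 := (Num.truncn (3 / delta * (C1 + #|A|%:R))).+1.
apply: (@sublinear_set_null e (expR (- (delta / 3))) N0) => //.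
  by rewrite expR_gt0 expR_lt1 oppr_lt0 divr_gt0.
move=> n nN0; rewrite leNgt; apply/negP => big; apply: _ null.
have n0 : (0 < n)%N by apply: leq_trans nN0.
pose D := e * n%:R.
have D0 : 0 <= D by rewrite mulr_ge0// ltW.
(* Rounding up gives the domination required of [K]; adding [j] gives [j <= K]. *)
pose K := ((Num.truncn (C0 + D)).+1 + j)%N.
have K_le : K%:R <= C0 + D + 1 + j%:R.
  rewrite /K natrD -natr1 lerD2r lerD2r truncn_le.
  exact: addr_ge0.
have K_ge : L%:R * Bp + (D + Vp) + L%:R * Bp + (j * corr)%:R * Bp <= K%:R.
  have : C0 + D < (Num.truncn (C0 + D)).+1%:R by exact: truncnS_gt.
  have : (0 : R) <= j%:R by [].
  rewrite /K natrD /C0; move: (L%:R * Bp) ((j * corr)%:R * Bp) => x y; lra.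
pose len := (L + L + (j + K) * corr)%N.
have lenB : s * (Vu + len%:R * Bu) <= C1 + cB * D.
  have -> : C1 + cB * D = s * (Vu + (L + L + (j + 1 + j) * corr)%:R * Bu +
    corr%:R * C0 * Bu + corr%:R * Bu * D) by rewrite /C1 /cB; ring.
  rewrite ler_pM2l// /len; clearbody C0 D K corr j; rewrite !natrD !natrM !natrD.
  have cB1 : 0 <= corr%:R * Bu by rewrite mulr_ge0.
  have h := ler_wpM2r cB1 K_le; lra.
(* Pigeonhole over first letters: fixing one loses at most the factor [#|A|]. *)
have [a ha] : exists a, expR (- (delta / 3)) ^+ n <= #|A|%:R *
    \sum_(o : n.-tuple A | good_word phi D n o && (head a0 o == a))
      expR (t * word_sup (M := M) o (\- u)).
  apply: contrapT => /forallNP na; move: big; apply/negP; rewrite -leNgt.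
  have A0 : 0 < #|A|%:R :> R by rewrite ltr0n; apply/card_gt0P; exists a0.
  rewrite (partition_big (fun o : n.-tuple A => head a0 o) xpredT)//=.
  apply: (@le_trans _ _ (\sum_(a : A) expR (- (delta / 3)) ^+ n / #|A|%:R)).
    apply: ler_sum => a _; rewrite ler_pdivlMr// mulrC ltW// ltNge; exact/negP/na.
  by rewrite sumr_const -[_ *+ _]mulr_natr divfK ?gt_eqF.
apply: (@uniform_avoiding_measure_neq0 R A M u phi Bu Vu umin Bp Vp D s a0 a
  P N e1 e2 L n j K _ _ _ _ _ _ _ _ _ _ _ _ _ _ _ _ _ W Q) => //; first exact: leq_addl.
have term (o : n.-tuple A) : good_word phi D n o ->
  expR (t * word_sup (M := M) o (\- u)) * expR (delta * n%:R - s * (Vu + len%:R * Bu)) <=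
  expR (s * (word_sup (M := M) o (\- u) - Vu - len%:R * Bu)).
  move=> /good_cylinder/word_sup_u; rewrite size_tuple => ws.
  rewrite -expRD ler_expR /delta.
  have ts : 0 <= t - s by rewrite subr_ge0 ltW.
  have := ler_wpM2l ts ws; move: (len%:R * Bu) (word_sup _ _) => x y; lra.
apply: (@le_trans _ _ (\sum_(o : n.-tuple A | good_word phi D n o && (head a0 o == a))
   expR (t * word_sup (M := M) o (\- u)) *
   expR (delta * n%:R - s * (Vu + len%:R * Bu)))); last first.
  by apply: ler_sum => o /andP[og _]; exact: term.
rewrite -mulr_suml; set S := \sum_(_ | _) _ in ha *.
have nlarge : C1 + #|A|%:R <= delta / 3 * n%:R.
  have h : 3 / delta * (C1 + #|A|%:R) <= n%:R.
    apply: ltW; apply: (lt_le_trans (truncnS_gt _)); by rewrite ler_nat.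
  have := ler_wpM2l (ltW (divr_gt0 delta0 (ltr0Sn R 2))) h.
  suff -> : delta / 3 * (3 / delta * (C1 + #|A|%:R)) = C1 + #|A|%:R by [].
  by field; rewrite gt_eqF.
have expA : #|A|%:R <= expR (#|A|%:R) :> R.
  by apply: (le_trans _ (expR_ge1Dx _)); rewrite lerDr.
have gain : expR (- (delta / 3)) ^+ n * expR (delta * n%:R - s * (Vu + len%:R * Bu)) >= #|A|%:R.
  apply: (le_trans expA); rewrite -expRM_natl -expRD ler_expR.
  have h : cB * D <= delta / 3 * n%:R by rewrite /D mulrA ler_wpM2r.
  move: lenB nlarge h; clearbody delta C1; move: (s * _) (cB * D) => x y *; lra.
have A0 : 0 < #|A|%:R :> R by rewrite ltr0n; apply/card_gt0P; exists a0.
rewrite -(ler_pM2l A0) mulr1 mulrA; apply: (le_trans gain).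
by rewrite ler_wpM2r// expR_ge0.
Qed.

End Pressure.

(** * Level sets and boundary values in terms of [phi] *)

Section LevelSets.
Context {R : realType} {A : finType} {M : rel A}.
Context (psi v : sft M -> R) (alpha Bv c : R).
Hypothesis vB : forall xi, `|v xi| <= Bv.
Hypothesis c0 : 0 < c.
Hypothesis v_le : forall xi, v xi <= - c.

Let phi xi : R := psi xi - alpha * v xi.

Let birkhoff_v n xi : n%:R * c <= - birkhoff n v xi.
Proof. by rewrite -birkhoffN; apply: birkhoff_ge => eta; rewrite lerNr. Qed.

Let birkhoff_v_lt0 n xi : (0 < n)%N -> birkhoff n v xi < 0.
Proof.
move=> n0; rewrite -oppr_gt0; apply: lt_le_trans (birkhoff_v n xi).
by rewrite mulr_gt0// ltr0n.
Qed.

Let birkhoff_phi n xi : (0 < n)%N ->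
  birkhoff n phi xi = (birkhoff_ratio psi v xi n - alpha) * birkhoff n v xi.
Proof.
move=> n0; rewrite birkhoff_lin mulrBl /birkhoff_ratio divfK//.
by rewrite lt_eqF// birkhoff_v_lt0.
Qed.

Lemma level_set_sublinear : level_set psi v alpha `<=` sublinear_set phi.
Proof.
move=> xi Lxi e e0.
have Bv0 : 0 <= Bv by apply: le_trans (vB xi); exact: normr_ge0.
have e1 : 0 < e / (Bv + 1) by rewrite divr_gt0// ltr_wpDl.
have /cvgrPdist_le/(_ _ e1) [N _ hN] := Lxi.
exists N.+1 => n nN; have n0 : (0 < n)%N by apply: leq_trans nN.
rewrite birkhoff_phi// normrM distrC.
have h1 := hN n (ltnW nN); have h2 := birkhoff_norm_le n xi vB.
apply: (le_trans (ler_pM (normr_ge0 _) (normr_ge0 _) h1 h2)).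
rewrite mulrCA mulrC ler_wpM2r// -mulrA ler_piMr ?(ltW e0)// mulrC.
by rewrite ler_pdivrMr ?ltr_wpDl// mul1r lerDl.
Qed.

Lemma uniform_level_set_bounded xi :
  uniform_level_set psi v alpha xi <-> exists C : R, forall n, `|birkhoff n phi xi| <= C.
Proof.
rewrite /uniform_level_set /=; split=> [|[C hC]]; last first.
  apply: (@le_lt_trans _ _ C%:E); last exact: ltry.
  by apply: ge_ereal_sup => _ [n _ <-]; rewrite lee_fin -birkhoff_lin.
set S := ereal_sup _ => Sy.
have hS n : (0 < n)%N -> (`|birkhoff n phi xi|%:E <= S)%E.
  by move=> n0; apply: ereal_sup_ubound; exists n; rewrite // birkhoff_lin.
(* The supremum omits [n = 0], where the sum vanishes. *)
exists (fine S) => -[|n].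
  rewrite {1}/birkhoff big_ord0 normr0; apply: fine_ge0.
  by apply: le_trans (hS 1%N isT); rewrite lee_fin.
by move: (hS n.+1 isT) Sy; case: S {hS} => [r| |] //=; rewrite lee_fin.
Qed.

Lemma uniform_level_set_sub : uniform_level_set psi v alpha `<=` level_set psi v alpha.
Proof.
move=> xi /uniform_level_set_bounded[C hC]; apply/cvgrPdist_le => e e0.
have ec0 : 0 < e * c by rewrite mulr_gt0.
exists (Num.truncn (C / (e * c))).+1 => // n /= nN.
have n0 : (0 < n)%N by apply: leq_trans nN.
have n0R : 0 < n%:R :> R by rewrite ltr0n.
have Cn : C <= e * (n%:R * c).
  rewrite mulrCA -ler_pdivrMr//; apply: ltW; apply: (lt_le_trans (truncnS_gt _)).
  by rewrite ler_nat.
have nc0 : 0 < n%:R * c by rewrite mulr_gt0.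
rewrite -(ler_pM2r nc0); apply: le_trans Cn; apply: le_trans (hC n).
rewrite birkhoff_phi// normrM distrC ler_wpM2l//.
by rewrite ltr0_norm ?birkhoff_v_lt0.
Qed.

Lemma ereal_lt_between (x : \bar R) (a : R) : (x < a%:E)%E ->
  exists2 b, b < a & (x <= b%:E)%E.
Proof.
case: x => [r| |]// h; last by exists (a - 1); rewrite ?leNye// ltrBlDr ltrDl.
by exists r.
Qed.

Lemma lt_limn_einf_frequently (w : R^nat) (b : R) :
  (limn_einf (EFin \o w) < b%:E)%E -> forall N, exists2 n, (N <= n)%N & w n < b.
Proof.
move=> h N; apply: contrapT => hN; move: h; apply/negP; rewrite -leNgt.
rewrite limn_einf_lim; apply: lime_ge; first exact: is_cvg_einfs.
exists N => // n /= Nn; apply: le_ereal_inf_tmp => _ [k /= nk <-].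
rewrite lee_fin leNgt; apply/negP => wk; apply: hN; exists k => //.
exact: leq_trans nk.
Qed.

Let unbounded (f : sft M -> R) (d : R) xi : 0 < d ->
  (forall N, exists2 n, (N <= n)%N & d * (n%:R * c) <= birkhoff n f xi) ->
  forall K, exists n, K <= birkhoff n f xi.
Proof.
move=> d0 h K; have dc0 : 0 < d * c by rewrite mulr_gt0.
have [n nN hn] := h (Num.truncn (K / (d * c))).+1; exists n.
apply: le_trans hn; rewrite mulrCA -ler_pdivrMr//.
by apply: ltW; apply: (lt_le_trans (truncnS_gt _)); rewrite ler_nat.
Qed.

(** Since [v] is negative, a ratio below [b < alpha] gives a sum of [phi] of at least
    [(alpha - b) * (n%:R * c)], and this happens for arbitrarily large [n]. *)
Lemma unbounded_above : (alpha_minus psi v < alpha%:E)%E ->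
  forall K, exists xi n, K <= birkhoff n phi xi.
Proof.
move=> /ereal_inf_lt[_ [xi _ <-]] /ereal_lt_between[b0 b0a h] K; exists xi.
have [b b0b ba] : exists2 b, b0 < b & b < alpha by exists ((b0 + alpha) / 2); lra.
have hb : (limn_einf (EFin \o birkhoff_ratio psi v xi) < b%:E)%E.
  by apply: (le_lt_trans h); rewrite lte_fin.
apply: (@unbounded _ (alpha - b)); rewrite ?subr_gt0// => N.
have [n nN rn] := lt_limn_einf_frequently hb N.+1.
have n0 : (0 < n)%N by apply: leq_trans nN.
exists n; first exact: ltnW.
have := birkhoff_v n xi; rewrite birkhoff_phi//; move: rn (birkhoff_v_lt0 xi n0).
move: (birkhoff_ratio _ _ _ _) (birkhoff n v xi) (n%:R * c) => r S nc *; nra.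
Qed.

Lemma unbounded_below : (alpha%:E < alpha_plus psi v)%E ->
  forall K, exists xi n, K <= birkhoff n (\- phi) xi.
Proof.
move=> /ereal_sup_gt[_ [xi _ <-]]; rewrite -lteN2 -limn_einfN.
rewrite -EFinN => /ereal_lt_between[b0 b0a h] K; exists xi.
have [b b0b ba] : exists2 b, b0 < b & b < - alpha by exists ((b0 - alpha) / 2); lra.
have hb : (limn_einf (EFin \o (fun n => (- birkhoff_ratio psi v xi n)%R)) < b%:E)%E.
  by apply: (le_lt_trans h); rewrite lte_fin.
apply: (@unbounded _ (- alpha - b)); rewrite ?subr_gt0// => N.
have [n nN rn] := lt_limn_einf_frequently hb N.+1.
have n0 : (0 < n)%N by apply: leq_trans nN.
exists n; first exact: ltnW.
have := birkhoff_v n xi; rewrite birkhoffN birkhoff_phi//; move: rn (birkhoff_v_lt0 xi n0).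
move: (birkhoff_ratio _ _ _ _) (birkhoff n v xi) (n%:R * c) => r S nc *; nra.
Qed.

(** At a point of the level set the lower and upper limits both equal [alpha]; excluding the two
    boundary values then makes the inequalities strict. *)
Lemma level_set_bounds xi : level_set psi v alpha xi ->
  (alpha_minus psi v <= alpha%:E <= alpha_plus psi v)%E.
Proof.
move=> Lxi.
have Lxi' : (EFin \o birkhoff_ratio psi v xi) n @[n --> \oo] --> alpha%:E.
  by apply: cvg_EFin Lxi; exact: nearW.
have [li ls] := cvg_limn_einf_sup Lxi'; apply/andP; split.
  by rewrite -li; apply: ereal_inf_lbound; exists xi.
by rewrite -ls; apply: ereal_sup_ubound; exists xi.
Qed.

End LevelSets.

Theorem theorem1p3 (R : realType) (A : finType) (M : rel A)
  (hA : (2 <= #|A|)%N)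
  (hM : forall a : A, exists b : A, M a b)
  (htrans : topologically_transitive M)
  (psi v u : sft M -> R)
  (hpsi : hoelder_continuous psi)
  (hv : hoelder_continuous v) (hv_neg : forall xi, v xi < 0)
  (hu : hoelder_continuous u) (hu_pos : forall xi, 0 < u xi)
  (W : set (seq A)) (hWfin : finite_set W)
  (hW : forall w, W w -> w <> [::] /\ admissible M w)
  (alpha : R)
  (halpha_minus : alpha%:E <> alpha_minus psi v)
  (halpha_plus : alpha%:E <> alpha_plus psi v) :
  dim_u u (uniform_level_set psi v alpha `&` avoid_some_power W) =
  dim_u u (level_set psi v alpha).
Proof.
have [Bp Bp0 psiB] := hoelder_bounded hpsi.
have [Bv Bv0 vB] := hoelder_bounded hv.
have [Bu _ uB] := hoelder_bounded hu.
have [Vp _ psiV] := hoelder_distortion hpsi.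
have [Vv _ vV] := hoelder_distortion hv.
have [Vu _ uV] := hoelder_distortion hu.
have [umin umin0 u_ge] := hoelder_pos_lower_bound hu hu_pos.
have [c c0 v_le] : exists2 c, 0 < c & forall xi, v xi <= - c.
  have hNv : hoelder_continuous (\- v).
    case: hv => theta [C [theta0 h]]; exists theta, C; split=> // xi xi'.
    by rewrite /= -opprD normrN.
  have [|c c0 hc] := hoelder_pos_lower_bound hNv.
    by move=> xi; rewrite /= oppr_gt0.
  by exists c => // xi; rewrite lerNr; exact: hc.
set phi := fun xi => psi xi - alpha * v xi.
have phiB xi : `|phi xi| <= Bp + `|alpha| * Bv.
  by rewrite (le_trans (ler_normB _ _))// normrM lerD// ler_wpM2l.
have phiV : distortion_le phi (Vp + `|alpha| * Vv) by exact: distortion_lin.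
apply/eqP; rewrite eq_le; apply/andP; split.
  apply: hausdorff_dimS => xi [Uxi _].
  exact: (uniform_level_set_sub c0 v_le).
apply: hausdorff_dim_le => [|s t s0 st null]; first exact: dist_u_ge0.
(* Only a nonempty level set places [alpha] between the boundary values; an empty one is null
   anyway. *)
have [[xi Lxi]|L0] := pselect (exists xi, level_set psi v alpha xi); last first.
  apply: (hausdorff_measure_eq0S (F := uniform_level_set psi v alpha `&` avoid_some_power W)).
  - by move=> xi Lxi; case: L0; exists xi.
  - by apply: hausdorff_measure_eq0_le null; [exact: dist_u_ge0|exact: ltW|exact: ltW].
have /andP[am ap] := level_set_bounds Lxi.
have am' : (alpha_minus psi v < alpha%:E)%E.
  by rewrite lt_neqAle am andbT; apply/eqP => /esym.
have ap' : (alpha%:E < alpha_plus psi v)%E by rewrite lt_neqAle ap andbT; apply/eqP.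
apply: (hausdorff_measure_eq0S (F := sublinear_set phi)).
  exact: level_set_sublinear vB c0 v_le.
apply: (avoiding_bounded_null uB uV umin0 u_ge phiB phiV s0 st htrans _ _ hWfin).
- exact: unbounded_above c0 v_le am'.
- exact: unbounded_below c0 v_le ap'.
- by move=> w /hW[].
apply: hausdorff_measure_eq0S null.
by apply: setSI => xi'; exact: (uniform_level_set_bounded _ _ _ _).2.
Qed.
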